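(* Let $\mathcal{H}$ and $\widetilde{\mathcal{H}}$ be separable complex Hilbert spaces, let $P=(P_t)_{t\ge 0}$ be a contraction semigroup on $\mathcal{H}$ and let $\widetilde{P}=(e^{-t\widetilde{\mathbf{A}}})_{t\ge 0}$ be a contraction semigroup on $\widetilde{\mathcal{H}}$, where $\widetilde{\mathbf{A}}$ is a normal operator with spectral gap $\gamma_1>0$ and resolution of identity $\mathsf{E}$. Let $\Lambda:\widetilde{\mathcal{H}}\to\mathcal{H}$ be a proper intertwining operator: $\Lambda$ is bounded and linear, $P_t\Lambda=\Lambda\widetilde{P}_t$ for all $t\ge 0$, $\mathrm{Ran}(\Lambda)$ is dense in $\mathcal{H}$, and $\mathsf{E}_\Omega\big(\overline{\mathrm{Ran}(\Lambda^* )}\big)\subseteq\overline{\mathrm{Ran}(\Lambda^* )}$ for every Borel set $\Omega\subseteq\mathbb{C}$. Put $\mathsf{F}_\Omega=\Lambda\mathsf{E}_\Omega\Lambda^\dagger$ on $\mathrm{Ran}(\Lambda)$ for each Borel $\Omega\subseteq\mathbb{C}$. Assume that there exist $m\in L^\infty(\sigma(\widetilde{\mathbf{A}}))$ and a constant $T_m>0$ such that (a) for all $(f,g)\in\mathrm{Ran}(\Lambda)\times\mathcal{H}$, $$\int_{\sigma(\widetilde{\mathbf{A}})}|m(\gamma)|\,d|\langle\mathsf{F}_\gamma f,g\rangle_{\mathcal{H}}|\le\|f\|_{\mathcal{H}}\|g\|_{\mathcal{H}};$$ (b) for every $t>T_m$, the function $\gamma\mapsto e^{-\gamma t}/m(\gamma)$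 belongs to $L^\infty(\sigma(\widetilde{\mathbf{A}}))$. Then: (1) For $t>T_m$, the operator $\int_{\sigma(\widetilde{\mathbf{A}})}e^{-\gamma t}\,d\mathsf{F}_\gamma$ (defined on $\mathrm{Ran}(\Lambda)$) extends to a bounded linear operator on $\mathcal{H}$. (2) Let $M_t^{(\gamma_1)}(\gamma)=\frac{e^{-\gamma t}}{m(\gamma)}\mathbf{1}_{\{\mathrm{Re}(\gamma)\ge\gamma_1\}}$ for $\gamma\in\sigma(\widetilde{\mathbf{A}})$. Then, for all $f\in\mathcal{H}$ and $t>T_m$, $$\|P_tf-P_\infty f\|_{\mathcal{H}}\le\|M_t^{(\gamma_1)}\|_\infty\,\|f-P_\infty f\|_{\mathcal{H}}.$$ If $M_t^{(\gamma_1)}$ attains its supremum at $\gamma_1$ (that is, $\gamma_1\in\sigma(\widetilde{\mathbf{A}})$ and $|M_t^{(\gamma_1)}(\gamma_1)|=\|M_t^{(\gamma_1)}\|_\infty$), then for all $f\in\mathcal{H}$ and $t>T_m$, $$\|P_tf-P_\infty f\|_{\mathcal{H}}\le\frac{1}{|m(\gamma_1)|}e^{-\gamma_1t}\,\|f-P_\infty f\|_{\mathcal{H}}.$$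
   Context: A contraction semigroup on a Hilbert space is a strongly continuous one-parameter semigroup $(P_t)_{t\ge0}$ of bounded operators with $P_0=I$ and $\|P_t\|\le1$; writing $P=(e^{-t\mathbf{A}})_{t\ge0}$ means that its generator is $-\mathbf{A}$. $P_\infty$ is the orthogonal projection onto $\{f\in\mathcal{H}: P_tf=f\ \forall t\ge0\}$. For a normal operator $\widetilde{\mathbf{A}}$ (densely defined, $\widetilde{\mathbf{A}}\widetilde{\mathbf{A}}^*=\widetilde{\mathbf{A}}^*\widetilde{\mathbf{A}}$), $\mathsf{E}$ is its unique projection-valued spectral measure on the Borel sets of $\mathbb{C}$, so that $\widetilde{P}_t=\int_{\sigma(\widetilde{\mathbf{A}})}e^{-\gamma t}d\mathsf{E}_\gamma$. A normal operator $\widetilde{\mathbf{A}}$ with $\sigma(\widetilde{\mathbf{A}})\subseteq\{\mathrm{Re}(z)\ge0\}$ has spectral gap $\gamma_1$ if $$\gamma_1=\inf\{\mathrm{Re}(\gamma):\gamma\in\sigma(\widetilde{\mathbf{A}}),\ \mathrm{Re}(\gamma)>0\}=\inf\Big\{\tfrac{\mathrm{Re}\langle\widetilde{\mathbf{A}}f,f\rangle}{\|f\|^2}:0\ne f\in\mathcal{D}(\widetilde{\mathbf{A}}),\ f\perp\mathrm{Ker}(\widetilde{\mathbf{A}})\Big\}>0.$$ $\Lambda^\dagger$ is the (Moore–Penrose) pseudo-inverse of $\Lambda$; since $\mathrm{Ran}(\Lambda)$ is dense its domain is $\mathrm{Ran}(\Lambda)$: for $f\in\mathrm{Ran}(\Lambda)$,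 $\Lambda^\dagger f$ is the unique $h\in\mathrm{Ker}(\Lambda)^\perp$ with $\Lambda h=f$. For $(f,g)\in\mathrm{Ran}(\Lambda)\times\mathcal{H}$, $\Omega\mapsto\langle\mathsf{F}_\Omega f,g\rangle=\langle\mathsf{E}_\Omega\Lambda^\dagger f,\Lambda^*g\rangle$ is a complex measure, and $|\langle\mathsf{F}_\gamma f,g\rangle|$ denotes its total variation measure. For bounded Borel $\phi$ on $\sigma(\widetilde{\mathbf{A}})$, $\int\phi\,d\mathsf{F}_\gamma$ is the operator on $\mathrm{Ran}(\Lambda)$ with $\langle(\int\phi\,d\mathsf{F}_\gamma)f,g\rangle=\int\phi(\gamma)\,d\langle\mathsf{F}_\gamma f,g\rangle$. $L^\infty(\sigma(\widetilde{\mathbf{A}}))$ is the space of bounded complex-valued Borel functions on $\sigma(\widetilde{\mathbf{A}})$ with the uniform norm $\|\cdot\|_\infty$. *)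

(* Defs.v *)
From HB Require Import structures.
From mathcomp Require Import all_boot all_order all_algebra.
From mathcomp Require Import all_classical all_reals all_analysis.
From mathcomp Require Import complex sesquilinear.

Set Implicit Arguments.
Unset Strict Implicit.
Unset Printing Implicit Defensive.

Import Order.TTheory GRing.Theory Num.Theory.
Import numFieldNormedType.Exports.

Local Open Scope classical_set_scope.
Local Open Scope ring_scope.
Local Open Scope complex_scope.

HB.instance Definition _ (R : rcfType) := NormedModule.copy R[i] R[i]^o.

(* On a normed module over [R[i]] the norm [`|x|] is a nonnegative element of
   [R[i]]; [rnorm x] is the same number in [R]. *)
Definition rnorm (R : realType) (V : normedZmodType R[i]) (x : V) : R :=
  complex.Re `|x|.

Definition cexp (R : realType) (z : R[i]) : R[i] :=
  (expR (complex.Re z) * cos (complex.Im z))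
    +i* (expR (complex.Re z) * sin (complex.Im z)).

(* [R[i]] with its Borel sigma-algebra; convertible to [R[i]]. *)
Definition Cborel (R : realType) := g_sigma_algebraType (@open R[i]).
HB.instance Definition _ (R : realType) := Measurable.on (Cborel R).

Section RnormTheory.
Context (R : realType).

Lemma rnormE (V : normedZmodType R[i]) (x : V) : `|x| = (rnorm x)%:C.
Proof.
have := normr_ge0 x; rewrite /rnorm; case: `|x| => a b /=.
by rewrite lecE /= => /andP[/eqP -> _].
Qed.

Lemma rnorm_ge0 (V : normedZmodType R[i]) (x : V) : 0 <= rnorm x.
Proof. by have := normr_ge0 x; rewrite rnormE lecR. Qed.

Lemma rnorm0 (V : normedZmodType R[i]) : rnorm (0 : V) = 0.
Proof. by rewrite /rnorm normr0. Qed.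

Lemma ler_rnormD (V : normedZmodType R[i]) (x y : V) :
  rnorm (x + y) <= rnorm x + rnorm y.
Proof. by have := ler_normD x y; rewrite !rnormE -rmorphD lecR. Qed.

Lemma ler_rnorm_sum (V : normedZmodType R[i]) (I : Type) (r : seq I) (u : I -> V) :
  rnorm (\sum_(i <- r) u i) <= \sum_(i <- r) rnorm (u i).
Proof.
elim: r => [|i r ih]; first by rewrite !big_nil rnorm0.
by rewrite !big_cons (le_trans (ler_rnormD _ _))// lerD2l.
Qed.

Lemma ler_rnormB (V : normedZmodType R[i]) (x y : V) :
  `|rnorm x - rnorm y| <= rnorm (x - y).
Proof.
rewrite ler_norml lerBlDr lerNl opprB lerBlDr; apply/andP; split.
  have := ler_rnormD (y - x) x.
  by rewrite subrK [rnorm (y - x)]/rnorm distrC.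
by have := ler_rnormD (x - y) y; rewrite subrK.
Qed.

Lemma ler_norm_Re (z : R[i]) : `|complex.Re z| <= rnorm z.
Proof. by have := normc_ge_Re z; rewrite rnormE lecR. Qed.

Lemma ler_norm_Im (z : R[i]) : `|complex.Im z| <= rnorm z.
Proof.
rewrite /rnorm normc_def /= -sqrtr_sqr ler_wsqrtr//.
by rewrite lerDr sqr_ge0.
Qed.

Lemma cvg_rnormP (V : normedModType R[i]) (T : Type) (F : set_system T)
    (FF : Filter F) (f : T -> V) (l : V) :
  f @ F --> l <-> forall e : R, 0 < e -> \forall x \near F, rnorm (l - f x) < e.
Proof.
split=> [/cvgrPdist_lt fl e e0|fl].
  have /fl : 0 < e%:C by rewrite ltcR.
  by apply: filterS => x; rewrite rnormE ltcR.
apply/cvgrPdist_lt => e e0.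
have eE : e = (complex.Re e)%:C.
  by move: e0; rewrite ltcE /=; case: e => a b /= /andP[/eqP -> _].
have /fl : 0 < complex.Re e by move: e0; rewrite eE ltcR.
by apply: filterS => x; rewrite rnormE {2}eE ltcR.
Qed.

Lemma cvg_dist_le (V : normedModType R[i]) (T : Type) (F : set_system T)
    (FF : Filter F) (f : T -> V) (l : V) (g : T -> R) (a : R) :
  f @ F --> l -> (forall x, `|a - g x| <= rnorm (l - f x)) -> g @ F --> a.
Proof.
move=> /cvg_rnormP fl gf; apply/cvgrPdist_lt => e /fl.
by apply: filterS => x; exact: le_lt_trans.
Qed.

End RnormTheory.

Record complex_measure d (T : measurableType d) (R : realType) :=
  ComplexMeasure {
    cmeas :> set T -> R[i];
    cmeas0 : cmeas set0 = 0;
    cmeas_sigma_additive : forall F : (set T)^nat,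
      (forall n, measurable (F n)) -> trivIset setT F ->
      series (fun n => cmeas (F n)) @ \oo --> cmeas (\bigcup_n F n) }.

Section TotalVariation.
Context d (T : measurableType d) (R : realType).
Variable mu : complex_measure T R.

Definition mpartition (A : set T) (n : nat) (F : nat -> set T) : Prop :=
  [/\ forall i, measurable (F i), trivIset `I_n F & \bigcup_(i < n) F i = A].

(* The maximum with 0 only matters for non-measurable [A], which have no
   measurable partition at all. *)
Definition tv (A : set T) : \bar R :=
  maxe 0%E (ereal_sup [set s : \bar R | exists n F, mpartition A n F /\
    s = (\sum_(0 <= i < n) (rnorm (mu (F i)))%:E)%E]).

Local Open Scope ereal_scope.

Lemma tv_ge0 A : 0 <= tv A. Proof. by rewrite le_max lexx. Qed.

Lemma tv_ge A n F : mpartition A n F ->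
  \sum_(0 <= i < n) (rnorm (mu (F i)))%:E <= tv A.
Proof.
move=> AF; rewrite le_max; apply/orP; right.
by apply: ereal_sup_ubound; exists n, F.
Qed.

Lemma tv_le A (c : \bar R) : 0 <= c ->
  (forall n F, mpartition A n F ->
    \sum_(0 <= i < n) (rnorm (mu (F i)))%:E <= c) ->
  tv A <= c.
Proof.
move=> c0 h; rewrite ge_max c0 /=.
by apply: ge_ereal_sup => _ [n [F [AF ->]]]; exact: h.
Qed.

Lemma tv0 : tv set0 = 0.
Proof.
apply/eqP; rewrite eq_le tv_ge0 andbT; apply: tv_le => // n F [_ _ F0].
rewrite big_nat big1// => i; rewrite leq0n /= => iN.
suff -> : F i = set0 by rewrite cmeas0 rnorm0.
by apply/seteqP; split => // x Fx; rewrite -F0; exists i.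
Qed.

Lemma mpartitionU A B n F m G : [disjoint A & B] ->
  mpartition A n F -> mpartition B m G ->
  mpartition (A `|` B) (n + m) (fun i => if (i < n)%N then F i else G (i - n)%N).
Proof.
move=> /disj_setPS AB [mF tF FA] [mG tG GB]; split.
- by move=> i; case: ifP.
- move=> i j /= iN jN [x []].
  case: ifPn => [ilt|ige]; case: ifPn => [jlt|jge] xi xj.
  + by apply: tF => //; exists x.
  + exfalso; apply: (AB x); split; first by rewrite -FA; exists i.
    rewrite -GB; exists (j - n)%N => //=.
    by rewrite ltn_subLR// leqNgt.
  + exfalso; apply: (AB x); split; first by rewrite -FA; exists j.
    rewrite -GB; exists (i - n)%N => //=.
    by rewrite ltn_subLR// leqNgt.
  + rewrite -!leqNgt in ige jge.
    have : (i - n = j - n)%N.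
      by apply: tG => /=; rewrite ?ltn_subLR//; exists x.
    by move/(congr1 (addn n)); rewrite !subnKC.
- rewrite -FA -GB; apply/seteqP; split => x.
  + move=> [i /= iN]; case: ifPn => [ilt|ige] xi; first by left; exists i.
    by right; exists (i - n)%N => //=; rewrite ltn_subLR// leqNgt.
  + move=> [[i /= iN xi]|[i /= iM xi]].
      by exists i => /=; [exact: ltn_addr|rewrite iN].
    exists (n + i)%N => /=; first by rewrite ltn_add2l.
    by rewrite ltnNge leq_addr /= addKn.
Qed.

Lemma tvU A B : [disjoint A & B] -> measurable A -> measurable B ->
  tv A + tv B <= tv (A `|` B).
Proof.
move=> AB mA mB.
have h n F m G : mpartition A n F -> mpartition B m G ->
    \sum_(0 <= i < n) (rnorm (mu (F i)))%:E +
    \sum_(0 <= i < m) (rnorm (mu (G i)))%:E <= tv (A `|` B).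
  move=> AF BG; apply: le_trans (tv_ge (mpartitionU AB AF BG)).
  rewrite (@big_cat_nat _ _ _ n 0%N (n + m)%N)//= ?leq_addr//; apply: leeD.
    rewrite !big_nat; apply: lee_sum => i; rewrite leq0n /= => iN.
    by rewrite iN.
  rewrite -[X in _ <= \sum_(X <= _ < _) _]add0n big_addn addKn.
  by apply: lee_sum => i _; rewrite ltnNge leq_addl /= addnK.
have [->|tvfin] := eqVneq (tv (A `|` B)) +oo; first exact: leey.
have UF : tv (A `|` B) \is a fin_num by rewrite ge0_fin_numE ?tv_ge0// ltey.
have hfin n (F : nat -> set T) :
    \sum_(0 <= i < n) (rnorm (mu (F i)))%:E \is a fin_num.
  by rewrite sumEFin.
have mp1 D : measurable D -> mpartition D 1 (fun=> D).
  move=> mD; split => //; first by move=> i j /=; case: i j => [|//] [].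
  by apply/seteqP; split => [x [i _]//|x Dx]; exists 0%N.
have h1 n F : mpartition A n F ->
    \sum_(0 <= i < n) (rnorm (mu (F i)))%:E + tv B <= tv (A `|` B).
  move=> AF; rewrite -leeBrDl//; apply: tv_le => [|m G BG].
    rewrite leeBrDl// adde0; apply: le_trans (h _ _ _ _ AF (mp1 _ mB)).
    by rewrite leeDl// big_nat1 lee_fin rnorm_ge0.
  by rewrite leeBrDl//; exact: h.
have tvBfin : tv B \is a fin_num.
  rewrite ge0_fin_numE ?tv_ge0//; apply: le_lt_trans (_ : tv (A `|` B) < +oo).
    apply: le_trans (h1 _ _ (mp1 _ mA)).
    by rewrite leeDr// big_nat1 lee_fin rnorm_ge0.
  by rewrite ltey.
rewrite -leeBrDr//; apply: tv_le => [|n F AF].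
  rewrite leeBrDr// add0e; apply: le_trans (h1 _ _ (mp1 _ mA)).
  by rewrite leeDr// big_nat1 lee_fin rnorm_ge0.
by rewrite leeBrDr//; exact: h1.
Qed.

Lemma le_tv A B : measurable A -> measurable B -> A `<=` B -> tv A <= tv B.
Proof.
move=> mA mB AB; rewrite -(setDUK AB).
apply: le_trans (tvU _ mA (measurableD mB mA)).
  by rewrite leeDl// tv_ge0.
by apply/disj_setPS => x [Ax []].
Qed.

Lemma rnorm_cmeas_bigcup (F : (set T)^nat) :
  (forall n, measurable (F n)) -> trivIset setT F ->
  (rnorm (mu (\bigcup_n F n)))%:E <= \sum_(0 <= n <oo) (rnorm (mu (F n)))%:E.
Proof.
move=> mF tF; have c := @cmeas_sigma_additive _ _ _ mu F mF tF.
have c' : (fun N => rnorm (series (fun n => mu (F n)) N)) @ \oo -->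
    rnorm (mu (\bigcup_n F n)).
  by apply: cvg_dist_le c _ => N; exact: ler_rnormB.
set S := \sum_(0 <= n <oo) _.
have S0 : 0 <= S by apply: nneseries_ge0 => n _ _; rewrite lee_fin rnorm_ge0.
have [->|Sfin] := eqVneq S +oo; first exact: leey.
have SF : S \is a fin_num by rewrite ge0_fin_numE// ltey.
rewrite -(fineK SF) lee_fin -(cvg_lim _ c')//.
apply: limr_le; first by apply/cvg_ex; eexists; exact: c'.
apply: nearW => N; rewrite -lee_fin (fineK SF).
apply: le_trans (_ : \sum_(0 <= n < N) (rnorm (mu (F n)))%:E <= S); last first.
  by apply: nneseries_lim_ge => n _; rewrite lee_fin rnorm_ge0.
by rewrite sumEFin lee_fin ler_rnorm_sum.
Qed.

Lemma tv_semi_sigma_additive : semi_sigma_additive tv.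
Proof.
move=> F mF tF mU.
have -> : tv (\bigcup_n F n) = \sum_(0 <= n <oo) tv (F n); last first.
  by apply: is_cvg_nneseries => n _ _; exact: tv_ge0.
apply/eqP; rewrite eq_le; apply/andP; split.
- apply: tv_le => [|N G [mG tG GU]].
    by apply: nneseries_ge0 => n _ _; exact: tv_ge0.
  apply: (@le_trans _ _ (\sum_(0 <= k < N)
      \sum_(0 <= n <oo) (rnorm (mu (G k `&` F n)))%:E)).
    rewrite !big_nat; apply: lee_sum => k; rewrite leq0n /= => kN.
    have {1}-> : G k = \bigcup_n (G k `&` F n).
      rewrite -setI_bigcupr -GU; apply/esym/setIidl => x Gx.
      by exists k.
    apply: rnorm_cmeas_bigcup => [n|]; first exact: measurableI.
    exact: trivIset_setIl.
  rewrite -nneseries_sum_nat; last by move=> *; rewrite lee_fin rnorm_ge0.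
  apply: lee_nneseries => [n _ _|n _].
    by apply: sume_ge0 => *; rewrite lee_fin rnorm_ge0.
  apply: (@tv_ge (F n) N (fun k => G k `&` F n)); split.
  + by move=> i; exact: measurableI.
  + exact: trivIset_setIr.
  + rewrite -setI_bigcupl GU; apply/setIidr => x Fx.
    by exists n.
- apply: lime_le; first by apply: is_cvg_nneseries => n _ _; exact: tv_ge0.
  apply: nearW => N.
  apply: (@le_trans _ _ (tv (\bigcup_(i < N) F i))); last first.
    apply: le_tv => //; first exact: bigcup_measurable.
    by move=> x [i _ Fx]; exists i.
  elim: N => [|N ih]; first by rewrite big_nil tv_ge0.
  rewrite big_nat_recr//= bigcup_mkord big_ord_recr /= -bigcup_mkord.
  apply: le_trans (leeD2r _ ih) _.
  apply: tvU => //; last exact: bigcup_measurable.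
  apply/disj_setPS => x [[i /= iN Fi] FN].
  have iEN : i = N by apply: tF => //; exists x.
  by move: iN; rewrite iEN ltnn.
Qed.

HB.instance Definition _ :=
  isMeasure.Build d T R tv tv0 tv_ge0 tv_semi_sigma_additive.

End TotalVariation.

Section ComplexIntegral.
Context d (T : measurableType d) (R : realType).

Definition cmeas_re (mu : complex_measure T R) (A : set T) : \bar R :=
  (complex.Re (mu A))%:E.
Definition cmeas_im (mu : complex_measure T R) (A : set T) : \bar R :=
  (complex.Im (mu A))%:E.

Section Charges.
Variable mu : complex_measure T R.

Let re0 : cmeas_re mu set0 = 0%E. Proof. by rewrite /cmeas_re cmeas0. Qed.
Let im0 : cmeas_im mu set0 = 0%E. Proof. by rewrite /cmeas_im cmeas0. Qed.
Let re_fin A : measurable A -> cmeas_re mu A \is a fin_num. Proof. by []. Qed.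
Let im_fin A : measurable A -> cmeas_im mu A \is a fin_num. Proof. by []. Qed.

Let re_sigma : semi_sigma_additive (cmeas_re mu).
Proof.
move=> F mF tF _; have c := @cmeas_sigma_additive _ _ _ mu F mF tF.
under eq_fun do rewrite sumEFin.
apply: cvg_EFin; first exact: nearW.
apply: cvg_dist_le c _ => N /=.
by rewrite /series /= -(raddf_sum (@complex.Re R : Rcomplex R -> R)) -raddfB
  ler_norm_Re.
Qed.

Let im_sigma : semi_sigma_additive (cmeas_im mu).
Proof.
move=> F mF tF _; have c := @cmeas_sigma_additive _ _ _ mu F mF tF.
under eq_fun do rewrite sumEFin.
apply: cvg_EFin; first exact: nearW.
apply: cvg_dist_le c _ => N /=.
by rewrite /series /= -(raddf_sum (@complex.Im R : Rcomplex R -> R)) -raddfB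
  ler_norm_Im.
Qed.

HB.instance Definition _ :=
  isCharge.Build d T R (cmeas_re mu) re0 re_fin re_sigma.
HB.instance Definition _ :=
  isCharge.Build d T R (cmeas_im mu) im0 im_fin im_sigma.

End Charges.

Definition hahn_sets (nu : {charge set T -> \bar R}) :
  {PN : set T * set T | hahn_decomposition nu PN.1 PN.2}.
Proof.
apply: cid; have [P [N h]] := Hahn_decomposition nu.
by exists (P, N).
Defined.

Definition charge_integral (nu : {charge set T -> \bar R}) (D : set T)
    (h : T -> R) : R :=
  \int[jordan_pos (svalP (hahn_sets nu))]_(x in D) h x
  - \int[jordan_neg (svalP (hahn_sets nu))]_(x in D) h x.

Definition cintegral (mu : complex_measure T R) (D : set T) (phi : T -> R[i]) :
    R[i] :=
  let phi_re x := complex.Re (phi x) in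
  let phi_im x := complex.Im (phi x) in
  (charge_integral (cmeas_re mu) D phi_re
     - charge_integral (cmeas_im mu) D phi_im)
  +i* (charge_integral (cmeas_im mu) D phi_re
     + charge_integral (cmeas_re mu) D phi_im).

End ComplexIntegral.

HB.mixin Record isHilbert (R : realType) H & CompleteNormedModule R[i] H := {
  hdot : {dot H for (@Num.conj R[i])};
  hdot_norm : forall x : H, `|x| ^+ 2 = hdot x x }.

(* The inner product [hdot] is linear in its first argument. *)
#[short(type="hilbertType")]
HB.structure Definition Hilbert (R : realType) :=
  {H of CompleteNormedModule R[i] H & isHilbert R H}.

Definition separable (T : topologicalType) : Prop :=
  exists S : set T, countable S /\ dense S.

Section CauchySchwarz.
Context (R : realType) (H : hilbertType R).
Implicit Types x y : H.

Lemma rnorm_hdot x y : rnorm (hdot x y) <= rnorm x * rnorm y.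
Proof.
have [->|y0] := eqVneq y 0; first by rewrite linear0r !rnorm0 mulr0.
have yyN0 : hdot y y != 0 by rewrite -hdot_norm expf_neq0// normr_eq0.
have yx : hdot y x = Num.conj (hdot x y).
  by rewrite (hermC (hdot : {dot H for _}) y x) expr0 mul1r.
pose z := hdot y y *: x - hdot x y *: y.
have zy : hdot z y = 0.
  by rewrite linearBl /= !linearZl_LR /= mulrC subrr.
have : 0 <= hdot z x * hdot y y.
  have -> : hdot z x * hdot y y = hdot z z.
    rewrite [in RHS]/z linearBr /= !linearZr_LR /= zy mulr0 subr0 mulrC.
    by congr (_ * _); apply/esym/(@geC0_conj R[i]); rewrite -hdot_norm exprn_ge0.
  by rewrite -hdot_norm exprn_ge0.
rewrite linearBl /= !linearZl_LR /= yx -normCK -!hdot_norm.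
rewrite pmulr_lge0 ?exprn_gt0 ?normr_gt0// subr_ge0 -exprMn.
by rewrite ler_pXn2r ?nnegrE ?mulr_ge0// !rnormE -rmorphM /= lecR mulrC.
Qed.
End CauchySchwarz.

Record bounded_op (R : realType) (H K : hilbertType R) := BoundedOp {
  bop_fun :> {linear H -> K};
  bop_bounded : exists M : R, forall x : H, rnorm (bop_fun x) <= M * rnorm x }.

(* A possibly unbounded operator; the values of [opfun] outside [dom] are
   irrelevant. *)
Record unbounded_op (R : realType) (H K : hilbertType R) := UnboundedOp {
  dom : set H;
  opfun :> H -> K }.

Section Operators.
Context (R : realType).
Implicit Types H K G : hilbertType R.

Definition linear_op H K (A : unbounded_op H K) : Prop :=
  dom A 0 /\ forall (a : R[i]) (f g : H), dom A f -> dom A g ->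
    dom A (a *: f + g) /\ A (a *: f + g) = a *: A f + A g.

Definition op_eq H K (A B : unbounded_op H K) : Prop :=
  dom A = dom B /\ forall f, dom A f -> A f = B f.

Definition op_opp H K (A : unbounded_op H K) : unbounded_op H K :=
  UnboundedOp (dom A) (fun f => - A f).

Definition op_comp H K G (A : unbounded_op K G) (B : unbounded_op H K) :
    unbounded_op H G :=
  UnboundedOp [set f | dom B f /\ dom A (B f)] (fun f => A (B f)).

Definition total_op H K (L : bounded_op H K) : unbounded_op H K :=
  UnboundedOp setT L.

Definition op_range H K (A : unbounded_op H K) : set K := A @` dom A.

Definition op_ker H K (A : unbounded_op H K) : set H :=
  [set f | dom A f /\ A f = 0].

(* [adjoint A g] is the [h] of the definition of the domain; it is unique when
   [dom A] is dense. *)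
Definition adjoint H K (A : unbounded_op H K) : unbounded_op K H :=
  let is_adj g h := forall f, dom A f -> hdot (A f) g = hdot f h in
  UnboundedOp [set g | exists h, is_adj g h] (fun g => xget 0 [set h | is_adj g h]).

Definition normal_op H (A : unbounded_op H H) : Prop :=
  [/\ linear_op A, dense (dom A)
    & op_eq (op_comp A (adjoint A)) (op_comp (adjoint A) A)].

Definition orthocompl H (S : set H) : set H :=
  [set f | forall k, S k -> hdot f k = 0].

(* The default value 0 is never reached when [S] is a closed subspace. *)
Definition oproj H (S : set H) (f : H) : H :=
  xget 0 [set h | S h /\ orthocompl S (f - h)].

(* Moore-Penrose pseudo-inverse; meaningful only for [f] in the range of [L]. *)
Definition pinv H K (L : bounded_op H K) (f : K) : H :=
  xget 0 [set h | orthocompl (op_ker (total_op L)) h /\ L h = f].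

Definition resolvent_set H (A : unbounded_op H H) : set R[i] :=
  [set z | exists B : bounded_op H H,
     (forall f, dom A (B f) /\ z *: B f - A (B f) = f) /\
     (forall f, dom A f -> B (z *: f - A f) = f)].

Definition spectrum H (A : unbounded_op H H) : set R[i] := ~` resolvent_set A.

Definition spectral_gap H (A : unbounded_op H H) (gamma1 : R) : Prop :=
  [/\ spectrum A `<=` [set z | 0 <= complex.Re z],
      gamma1%:E = ereal_inf [set (complex.Re z)%:E | z in
        [set z | spectrum A z /\ 0 < complex.Re z]],
      gamma1%:E = ereal_inf
        [set (complex.Re (hdot (A f) f) / rnorm f ^+ 2)%:E | f in
          [set f | [/\ f != 0, dom A f & orthocompl (op_ker A) f]]]
    & 0 < gamma1].

(* Only the values [P t] with [0 <= t] are meaningful. *)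
Definition contraction_semigroup H (P : R -> bounded_op H H) : Prop :=
  [/\ forall f, P 0 f = f,
      forall s t, 0 <= s -> 0 <= t -> forall f, P (s + t) f = P s (P t f),
      forall f, P t f @[t --> 0^'+] --> f
    & forall t, 0 <= t -> forall f, rnorm (P t f) <= rnorm f].

Definition is_generator H (P : R -> bounded_op H H) (G : unbounded_op H H) :
    Prop :=
  forall f g, (dom G f /\ G f = g) <->
    (t^-1)%:C *: (P t f - f) @[t --> 0^'+] --> g.

Definition fixed_space H (P : R -> bounded_op H H) : set H :=
  [set f | forall t, 0 <= t -> P t f = f].

Definition P_infty H (P : R -> bounded_op H H) : H -> H :=
  oproj (fixed_space P).

End Operators.

Record pvm (R : realType) (H : hilbertType R) := Pvm {
  pvm_fun :> set (Cborel R) -> bounded_op H H;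
  pvm0 : forall f, pvm_fun set0 f = 0;
  pvmT : forall f, pvm_fun setT f = f;
  pvm_selfadjoint : forall O, measurable O ->
    forall f g, hdot (pvm_fun O f) g = hdot f (pvm_fun O g);
  pvmI : forall O1 O2, measurable O1 -> measurable O2 ->
    forall f, pvm_fun (O1 `&` O2) f = pvm_fun O1 (pvm_fun O2 f);
  pvm_sigma_additive : forall F : (set (Cborel R))^nat,
    (forall n, measurable (F n)) -> trivIset setT F ->
    forall f, series (fun n => pvm_fun (F n) f) @ \oo -->
      pvm_fun (\bigcup_n F n) f }.

Section SpectralIntegrals.
Context (R : realType).

Section PvmMeasure.
Context (H K : hilbertType R) (E : pvm H) (L : bounded_op H K).

Lemma hdot_pvm_sigma_additive (f : H) (g : K) (F : (set (Cborel R))^nat) :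
  (forall n, measurable (F n)) -> trivIset setT F ->
  series (fun n => hdot (L (E (F n) f)) g) @ \oo -->
    hdot (L (E (\bigcup_n F n) f)) g.
Proof.
move=> mF tF; apply/cvg_rnormP => e e0.
have [M LM] := bop_bounded L.
pose M' := `|M| + 1; have M'0 : 0 < M' by rewrite ltr_wpDl.
pose G := rnorm g + 1; have G0 : 0 < G by rewrite ltr_wpDl// rnorm_ge0.
have /cvg_rnormP/(_ (e / (M' * G))) := @pvm_sigma_additive _ _ E F mF tF f.
move=> /(_ (divr_gt0 e0 (mulr_gt0 M'0 G0))).
apply: filterS => N; rewrite ltr_pdivlMr ?mulr_gt0//.
apply: le_lt_trans; rewrite /series /=.
have -> : hdot (L (E (\bigcup_n F n) f)) g -
    \sum_(0 <= k < N) hdot (L (E (F k) f)) g =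
    hdot (L (E (\bigcup_n F n) f - \sum_(0 <= k < N) E (F k) f)) g.
  rewrite (linearB L) linearBl (linear_sum L); congr (_ - _).
  elim: (index_iota 0 N) => [|k r ih]; first by rewrite !big_nil linear0l.
  by rewrite !big_cons linearDl ih.
apply: (le_trans (rnorm_hdot _ _)); rewrite mulrA.
apply: ler_pM; rewrite ?rnorm_ge0//; last by rewrite lerDl.
apply: (le_trans (LM _)); rewrite mulrC ler_wpM2l ?rnorm_ge0//.
by rewrite (le_trans (ler_norm _))// lerDl.
Qed.

Lemma hdot_pvm0 (f : H) (g : K) : hdot (L (E set0 f)) g = 0.
Proof. by rewrite pvm0 linear0 linear0l. Qed.

End PvmMeasure.

Lemma id_bounded (H : hilbertType R) :
  exists M : R, forall x : H, rnorm (idfun x) <= M * rnorm x.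
Proof. by exists 1 => x; rewrite mul1r. Qed.

Definition id_op (H : hilbertType R) : bounded_op H H :=
  BoundedOp (@id_bounded H).

Definition pvm_measure (H : hilbertType R) (E : pvm H) (f g : H) :
    complex_measure (Cborel R) R :=
  @ComplexMeasure _ _ _ (fun O => hdot (E O f) g)
    (hdot_pvm0 E (id_op H) f g)
    (@hdot_pvm_sigma_additive _ _ E (id_op H) f g).

(* [E] is the resolution of the identity of [A], that is, [A] is the integral
   of [z] against [E]. The measure [<E f, f>] is nonnegative, so it is its own
   total variation. *)
Definition spectral_measure (H : hilbertType R) (A : unbounded_op H H)
    (E : pvm H) : Prop :=
  dom A = [set f |
    (\int[tv (pvm_measure E f f)]_z ((rnorm (z : R[i])) ^+ 2)%:E < +oo)%E] /\
  forall f g, dom A f ->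
    hdot (A f) g = cintegral (pvm_measure E f g) setT (fun z => z).

Definition F_op (H K : hilbertType R) (E : pvm H) (L : bounded_op H K)
    (O : set (Cborel R)) (f : K) : K :=
  L (E O (pinv L f)).

Definition F_measure (H K : hilbertType R) (E : pvm H) (L : bounded_op H K)
    (f g : K) : complex_measure (Cborel R) R :=
  @ComplexMeasure _ _ _ (fun O => hdot (F_op E L O f) g)
    (hdot_pvm0 E L (pinv L f) g)
    (@hdot_pvm_sigma_additive _ _ E L (pinv L f) g).

(* The integral of [phi] against [F], an operator on the range of [L], is
   defined weakly. *)
Definition extends_F_integral (H K : hilbertType R) (E : pvm H)
    (L : bounded_op H K) (D : set (Cborel R)) (phi : R[i] -> R[i])
    (T : bounded_op K K) : Prop :=
  forall f g, range L f -> hdot (T f) g = cintegral (F_measure E L f g) D phi.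

Definition proper_intertwining (H K : hilbertType R)
    (P : R -> bounded_op K K) (Q : R -> bounded_op H H) (E : pvm H)
    (L : bounded_op H K) : Prop :=
  [/\ forall t, 0 <= t -> forall f, P t (L f) = L (Q t f),
      dense (range L)
    & forall O : set (Cborel R), measurable O ->
        E O @` closure (op_range (adjoint (total_op L)))
          `<=` closure (op_range (adjoint (total_op L)))].

Definition Linfty (D : set R[i]) (phi : R[i] -> R[i]) : Prop :=
  measurable_fun (D : set (Cborel R)) (phi : Cborel R -> Cborel R) /\
  exists M : R, forall z, D z -> rnorm (phi z) <= M.

Definition supnorm (D : set R[i]) (phi : R[i] -> R[i]) : R :=
  sup [set rnorm (phi z) | z in D].

Definition M_fun (m : R[i] -> R[i]) (gamma1 t : R) (z : R[i]) : R[i] :=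
  if gamma1 <= complex.Re z then cexp (- (z * t%:C)) / m z else 0.

End SpectralIntegrals.

(* Main.v *)
Require Import Defs.
From HB Require Import structures.
From mathcomp Require Import all_boot all_order all_algebra.
From mathcomp Require Import all_classical all_reals all_analysis.
From mathcomp Require Import complex sesquilinear.
From mathcomp Require Import measurable_realfun ring lra.

Set Implicit Arguments.
Unset Strict Implicit.
Unset Printing Implicit Defensive.

Import Order.TTheory GRing.Theory Num.Theory.
Import numFieldNormedType.Exports.

Local Open Scope classical_set_scope.
Local Open Scope ring_scope.
Local Open Scope complex_scope.

(** Why the theorem holds. For [f = L h] the intertwining relation gives
    [P t f = L (Pt t h)], and by the spectral theorem [Pt t h] is the integral of
    [exp (- z t)] against [E], applied to [h]. Properness makes the kernel of [L]
    invariant under every projection [E X], so [L (E X h)] depends on [f] only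
    and equals [F_op E L X f] ([F_op_range]). Hence [P t] itself is the bounded
    operator that extends the integral of [exp (- z t)] against [F]
    ([semigroup_F_integral]).

    For the rate of convergence, cut [h] with [E {0}], the projection onto the
    kernel of [A]. The vector [L (E {0} h)] is fixed by [P]. The rest of [h] has
    its spectral measure on [Re z >= gamma1], so the brackets
    [<P t (f - L (E {0} h)), k>] decay exponentially; when [k] is fixed by [P]
    they do not depend on [t] at all, because a vector fixed by a contraction is
    fixed by its adjoint ([fixed_space_adjoint]). They vanish, and
    [L (E {0} h) = P_infty P f] ([P_infty_range]). The measures [<F f', g>] of
    [f' = f - P_infty P f] therefore live on [Re z >= gamma1], where
    [exp (- z t) = M z * m z], and the weighted bound on their total variation
    gives [|<P t f', g>| <= sup |M| * |f'| * |g|] ([semigroup_estimate_range]).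
    Contractivity carries the estimate from the dense range of [L] to all vectors
    ([semigroup_estimate_dense]).

    The spectral theory is derived from the assumption that [A] is the
    integral of [z] against [E]. On the range of [E X], with [X] inside a small
    disk around [z0], the operator [A] is nearly [z0] ([pvm_near]). If [z0] is in
    the resolvent set, or has [Re z0 < gamma1] and is not [0], this is only
    possible when that range is trivial, and countably many such disks cover the
    part of the plane concerned ([pvm_null_local]). The formula for [Pt t] comes
    from finite sums of [exp (- c_i t) E (F i) h] over a fine partition of a
    bounded part of the spectrum: such a sum solves the evolution equation up to
    a residual of the size of the mesh, and contractivity lets the errors of
    small time steps only add up ([semigroup_spectral_sum]). The same partitions
    give the integrals against complex measures ([cintegral_approx]) and their
    bound by the total variation ([rnorm_cintegral_le]). *)

(** * Complex moduli *)

Lemma subr_cancel (V : zmodType) (x y z : V) : (x - y) - (x - z) = z - y.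
Proof. by rewrite opprB addrC addrA subrK. Qed.

Lemma subrACA (V : zmodType) (x y z t : V) : (x - y) - (z - t) = (x - z) - (y - t).
Proof. by rewrite opprD addrACA -opprD. Qed.

Section ComplexNorm.
Context (R : realType).
Implicit Types (z w : R[i]) (V : normedModType R[i]).

Lemma rnormZ V z (x : V) : rnorm (z *: x) = rnorm z * rnorm x.
Proof. by rewrite {1}/rnorm normrZ !rnormE -rmorphM. Qed.

Lemma rnormM z w : rnorm (z * w) = rnorm z * rnorm w.
Proof. exact: (@rnormZ R[i]). Qed.

Lemma rnormN (V : normedZmodType R[i]) (x : V) : rnorm (- x) = rnorm x.
Proof. by rewrite /rnorm normrN. Qed.

Lemma rnormBC (V : normedZmodType R[i]) (x y : V) :
  rnorm (x - y) = rnorm (y - x).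
Proof. by rewrite -rnormN opprB. Qed.

Lemma rnorm_eq0 (V : normedZmodType R[i]) (x : V) : (rnorm x == 0) = (x == 0).
Proof.
rewrite -[RHS]normr_eq0 rnormE -(rmorph0 (real_complex R)).
by rewrite (inj_eq (@complexI R)).
Qed.

Lemma rnormC (r : R) : rnorm (r%:C : R[i]) = `|r|.
Proof. by rewrite /rnorm normc_def /= expr0n /= addr0 sqrtr_sqr. Qed.

Lemma rnorm1 : rnorm (1 : R[i]) = 1.
Proof. by have := rnormC 1; rewrite normr1. Qed.

Lemma rnormV z : rnorm z^-1 = (rnorm z)^-1.
Proof. by rewrite {1}/rnorm normfV rnormE -fmorphV. Qed.

Lemma rnorm_sqrE z : rnorm z ^+ 2 = complex.Re z ^+ 2 + complex.Im z ^+ 2.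
Proof.
by rewrite /rnorm normc_def /= sqr_sqrtr// addr_ge0 ?sqr_ge0.
Qed.

Lemma rnorm_leD z : rnorm z <= `|complex.Re z| + `|complex.Im z|.
Proof.
rewrite -(@ler_pXn2r _ 2) ?nnegrE ?rnorm_ge0 ?addr_ge0// rnorm_sqrE.
rewrite -(real_normK (num_real (complex.Re z))).
rewrite -(real_normK (num_real (complex.Im z))).
have := normr_ge0 (complex.Re z); have := normr_ge0 (complex.Im z).
move: `|complex.Re z| `|complex.Im z| => a b; nra.
Qed.

Lemma complexReD z w : complex.Re (z + w) = complex.Re z + complex.Re w.
Proof. by case: z w => [? ?] [? ?]. Qed.

Lemma complexImD z w : complex.Im (z + w) = complex.Im z + complex.Im w.
Proof. by case: z w => [? ?] [? ?]. Qed.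

Lemma complexReN z : complex.Re (- z) = - complex.Re z.
Proof. by case: z. Qed.

Lemma complexImN z : complex.Im (- z) = - complex.Im z.
Proof. by case: z. Qed.

Lemma complexReM z w : complex.Re (z * w) =
  complex.Re z * complex.Re w - complex.Im z * complex.Im w.
Proof. by case: z w => [? ?] [? ?]. Qed.

Lemma complexImM z w : complex.Im (z * w) =
  complex.Re z * complex.Im w + complex.Im z * complex.Re w.
Proof. by case: z w => [? ?] [? ?]. Qed.

Lemma complexRe_conj z : complex.Re (Num.conj z) = complex.Re z.
Proof. by case: z. Qed.

Lemma rnorm_conj z : rnorm (Num.conj z) = rnorm z.
Proof. by rewrite /rnorm norm_conjC. Qed.

Lemma le_addeps (x y : R) : (forall e, 0 < e -> x <= y + e) -> x <= y.
Proof. by move=> h; apply/ler_addgt0Pr. Qed.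

Lemma le_mulgt0 (x C : R) : (forall e, 0 < e -> x <= C * e) -> x <= 0.
Proof.
move=> h; apply: le_addeps => e e0; rewrite add0r.
have p : 0 < `|C| + 1 by rewrite ltr_wpDl.
apply: le_trans (h (e / (`|C| + 1)) (divr_gt0 e0 p)) _.
rewrite mulrA ler_pdivrMr// mulrC; apply: ler_wpM2l; first exact: ltW.
by rewrite (le_trans (ler_norm _))// lerDl.
Qed.

(** A linear perturbation dominated by a quadratic one vanishes: this turns a
    comparison of squared norms into an orthogonality relation. *)
Lemma first_order_eq0 z (K : R) :
  (forall a : R[i], 2 * complex.Re (a * z) <= rnorm a ^+ 2 * K) -> z = 0.
Proof.
move=> h; apply/eqP; rewrite -rnorm_eq0 -sqrf_eq0.
rewrite eq_le sqr_ge0 andbT; apply: (@le_mulgt0 _ (rnorm z ^+ 2 * `|K|)) => e e0.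
(* The direction of the conjugate of [z] gives [Re (a z) = e |z|^2]. *)
have := h (e%:C * Num.conj z).
rewrite -mulrA complexReM /= mul0r subr0 rnormM rnorm_conj rnormC.
rewrite (ger0_norm (ltW e0)).
rewrite rnorm_sqrE; case: z {h} => x y /=.
set q := x ^+ 2 + y ^+ 2.
have -> : x * x - - y * y = q by rewrite /q; ring.
have q0 : 0 <= q by rewrite addr_ge0 ?sqr_ge0.
rewrite exprMn rnorm_sqrE /= -/q => h1.
have {}h1 : 2 * q <= e * (q * K).
  by rewrite -(ler_pM2l e0); apply: le_trans (le_trans h1 _); lra.
have : q * K <= q * `|K| by rewrite ler_wpM2l// ler_norm.
move=> h2; have := ler_wpM2l (ltW e0) h2; nra.
Qed.

End ComplexNorm.

(** * Projections and adjoints in a Hilbert space *)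

Section Hilbert.
Context (R : realType) (H : hilbertType R).
Implicit Types (x y : H) (a : R[i]).

Lemma hdotxx x : hdot x x = (rnorm x ^+ 2)%:C.
Proof. by rewrite -hdot_norm rnormE -rmorphXn. Qed.

Lemma hdotC x y : hdot y x = Num.conj (hdot x y).
Proof. by rewrite (hermC (hdot : {dot H for _}) y x) expr0 mul1r. Qed.

Lemma hdot0C x y : hdot x y = 0 -> hdot y x = 0.
Proof. by move=> xy; rewrite hdotC xy rmorph0. Qed.

Lemma hdotZl a x y : hdot (a *: x) y = a * hdot x y.
Proof. by rewrite linearZl_LR. Qed.

Lemma hdotZr a x y : hdot x (a *: y) = Num.conj a * hdot x y.
Proof. by rewrite linearZr_LR. Qed.

Lemma rnorm_sqrD x y :
  rnorm (x + y) ^+ 2 = rnorm x ^+ 2 + rnorm y ^+ 2 + 2 * complex.Re (hdot x y).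
Proof.
have /(congr1 (@complex.Re R)) := hdotxx (x + y).
rewrite linearDl !linearDr /= !hdotxx (hdotC x y) !complexReD complexRe_conj /= => <-.
by ring.
Qed.

Lemma rnorm_sqrB x y :
  rnorm (x - y) ^+ 2 = rnorm x ^+ 2 + rnorm y ^+ 2 - 2 * complex.Re (hdot x y).
Proof. by rewrite rnorm_sqrD rnormN linearNr /= complexReN mulrN. Qed.

Lemma hdot_suml (I : Type) (r : seq I) (F : I -> H) y :
  hdot (\sum_(i <- r) F i) y = \sum_(i <- r) hdot (F i) y.
Proof.
elim: r => [|i r ih]; first by rewrite !big_nil linear0l.
by rewrite !big_cons linearDl /= ih.
Qed.

Lemma hdot_eq0 x : (forall y, hdot x y = 0) -> x = 0.
Proof.
move=> /(_ x); rewrite hdotxx => /(congr1 (@complex.Re R)) /= /eqP.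
by rewrite sqrf_eq0 rnorm_eq0 => /eqP.
Qed.

Lemma rnorm_le_hdot x (c : R) : 0 <= c ->
  (forall y, rnorm (hdot x y) <= c * rnorm y) -> rnorm x <= c.
Proof.
move=> c0 h; have [->|x0] := eqVneq x 0; first by rewrite rnorm0.
have xp : 0 < rnorm x by rewrite lt_neqAle rnorm_ge0 eq_sym rnorm_eq0 x0.
have := h x; rewrite hdotxx rnormC ger0_norm ?sqr_ge0// expr2.
by rewrite ler_pM2r.
Qed.

Lemma cvg_rnorm_seqP (V : normedModType R[i]) (u : nat -> V) (l : V) :
  u @ \oo --> l <->
  forall e : R, 0 < e -> exists N, forall n, (N <= n)%N -> rnorm (l - u n) < e.
Proof.
split=> [/cvg_rnormP h e /h [N _ uN]|h]; first by exists N => n Nn; exact: uN.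
by apply/cvg_rnormP => e /h [N uN]; exists N.
Qed.

Lemma rnorm_cauchy_cvg (u : nat -> H) :
  (forall e : R, 0 < e -> exists N, forall m n, (N <= m)%N -> (N <= n)%N ->
    rnorm (u m - u n) < e) -> exists l : H, u @ \oo --> l.
Proof.
move=> h; exists (lim (u @ \oo)); apply: cauchy_cvg.
apply/(cauchy_ballP (u @ \oo)) => e e0; rewrite near_map2.
have eE : e = (complex.Re e)%:C.
  by move: e0; rewrite ltcE /=; case: e => a b /= /andP[/eqP -> _].
have /h[N uN] : 0 < complex.Re e by move: e0; rewrite eE ltcR.
exists ([set n | (N <= n)%N], [set n | (N <= n)%N]) => /=.
  by split; exists N.
move=> [m n] [/= Nm Nn]; rewrite -ball_normE /= rnormE eE ltcR.
exact: uN.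
Qed.

(** The tails are dominated by a geometric series. *)
Lemma cauchy_step_cvg (u : nat -> H) (C q : R) : 0 <= q -> q < 1 ->
  (forall n, rnorm (u n.+1 - u n) <= C * q ^+ n) -> exists l : H, u @ \oo --> l.
Proof.
move=> q0 q1 uq; apply: rnorm_cauchy_cvg => e e0.
have q1' : 0 < 1 - q by rewrite subr_gt0.
have tail m k : rnorm (u (m + k)%N - u m) <= C * q ^+ m * (1 - q ^+ k) / (1 - q).
  elim: k => [|k ih]; first by rewrite addn0 subrr rnorm0 expr0 subrr mulr0 mul0r.
  have -> : u (m + k.+1)%N - u m =
      (u (m + k).+1 - u (m + k)%N) + (u (m + k)%N - u m).
    by rewrite addnS addrA subrK.
  apply: le_trans (ler_rnormD _ _) _; apply: le_trans (lerD (uq _) ih) _.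
  rewrite le_eqVlt; apply/orP; left; apply/eqP.
  by rewrite exprD exprS; field; exact: lt0r_neq0.
have C0 : 0 <= C.
  by have := uq 0%N; rewrite expr0 mulr1; apply: le_trans; exact: rnorm_ge0.
have : (fun n => C * q ^+ n / (1 - q)) @ \oo --> (0 : R).
  have -> : 0 = C * 0 / (1 - q) :> R by rewrite mulr0 mul0r.
  by apply: cvgMl; apply: cvgMr; apply: cvg_expr; rewrite ger0_norm.
move/cvgrPdist_lt => /(_ (e / 2)); rewrite divr_gt0// => /(_ isT)[N _ hN].
exists N => m n Nm Nn.
have tN k : (N <= k)%N -> rnorm (u k - u N) < e / 2.
  move=> Nk; have := hN N (leqnn N); rewrite /= sub0r normrN; apply: le_lt_trans.
  apply: le_trans (ler_norm _); rewrite -(subnKC Nk); apply: le_trans (tail _ _) _.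
  rewrite ler_wpM2r ?invr_ge0 ?(ltW q1')// ler_piMr ?mulr_ge0 ?exprn_ge0//.
  by rewrite lerBlDr lerDl exprn_ge0.
have -> : u m - u n = (u m - u N) - (u n - u N) by rewrite opprB addrA subrK.
rewrite (le_lt_trans (ler_rnormD _ _))// rnormN [e]splitr.
by apply: ltrD; exact: tN.
Qed.

(** Closedness is stated through distances, the form in which limits of
    minimizing sequences use it. *)
Definition closed_subspace (S : set H) : Prop :=
  [/\ S 0, forall a x y, S x -> S y -> S (a *: x + y)
    & forall x, (forall e : R, 0 < e -> exists2 s, S s & rnorm (x - s) < e) -> S x].

(** Projection theorem. A minimizing sequence for the distance from [x] to [S]
    is Cauchy by the parallelogram law, and its limit is orthogonal because no
    point of [S] is closer. *)
Lemma projection_exists (S : set H) (x : H) : closed_subspace S ->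
  exists h, S h /\ orthocompl S (x - h).
Proof.
move=> [S0 Slin Scl].
pose D := [set rnorm (x - s) | s in S].
have Dlb : has_inf D.
  split; first by exists (rnorm (x - 0)), 0.
  by exists 0 => _ [s _ <-]; exact: rnorm_ge0.
pose d := inf D.
have d0 : 0 <= d.
  by apply: lb_le_inf; [case: Dlb|move=> _ [s _ <-]; exact: rnorm_ge0].
have dle s : S s -> d <= rnorm (x - s).
  by move=> Ss; apply: ge_inf; [case: Dlb|exists s].
have near n : exists s, S s /\ rnorm (x - s) < d + n.+1%:R^-1.
  have n0 : 0 < n.+1%:R^-1 :> R by rewrite invr_gt0.
  by have [_ [s Ss <-] sd] := inf_adherent n0 Dlb; exists s.
have [u uP] := choice near.
have Shalf s t : S s -> S t -> S (2^-1 *: (s + t)).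
  move=> Ss St; rewrite scalerDr; apply: (Slin _ _ _ Ss).
  by rewrite -[_ *: t]addr0; exact: Slin.
have par s t : S s -> S t -> rnorm (s - t) ^+ 2 <=
    2 * rnorm (x - s) ^+ 2 + 2 * rnorm (x - t) ^+ 2 - 4 * d ^+ 2.
  move=> Ss St; have := dle _ (Shalf _ _ Ss St).
  rewrite -(@ler_pXn2r _ 2) ?nnegrE ?rnorm_ge0// => hd.
  have e1 : rnorm ((x - s) + (x - t)) ^+ 2 = 4 * rnorm (x - 2^-1 *: (s + t)) ^+ 2.
    have -> : (x - s) + (x - t) = 2 *: (x - 2^-1 *: (s + t)).
      rewrite scalerBr scalerA mulfV// scale1r scaler_nat mulr2n opprD.
      by rewrite addrACA.
    have -> : (2 : R[i]) = (2 : R)%:C by rewrite rmorph_nat.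
    by rewrite rnormZ rnormC exprMn ger0_norm//; congr (_ * _); ring.
  rewrite -(subr_cancel x).
  have := rnorm_sqrD (x - s) (x - t); rewrite e1 => e2.
  have := rnorm_sqrB (x - t) (x - s).
  by rewrite (hdotC (x - s)) complexRe_conj => ->; lra.
have eps_small (e : R) : 0 < e ->
    exists N : nat, forall n, (N <= n)%N -> n.+1%:R^-1 < e.
  move=> e0; have /cvgrPdist_lt/(_ _ e0)[N _ hN] := @cvg_harmonic R.
  exists N => n /hN /=; rewrite sub0r normrN ger0_norm//.
have [h uh] : exists l : H, u @ \oo --> l.
  apply: rnorm_cauchy_cvg => e e0.
  (* With both distances below [d + e'], the parallelogram law leaves
     [4 (2 d e' + e'^2) <= (8 d + 4) e'], which has to stay below [e^2]. *)
  pose e' := Num.min 1 (e ^+ 2 / (8 * d + 8)).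
  have d8 : 0 < 8 * d + 8 by lra.
  have e'0 : 0 < e' by rewrite lt_min ltr01 divr_gt0// exprn_gt0.
  have [N hN] := eps_small _ e'0; exists N => m n Nm Nn.
  rewrite -(@ltr_pXn2r _ 2) ?nnegrE ?rnorm_ge0 ?(ltW e0)//.
  have [[Sm um] [Sn un]] := (uP m, uP n).
  apply: le_lt_trans (par _ _ Sm Sn) _.
  have b s k : S s -> (N <= k)%N -> rnorm (x - s) < d + k.+1%:R^-1 ->
      rnorm (x - s) ^+ 2 < d ^+ 2 + 2 * d * e' + e'.
    move=> Ss Nk sk; have k1 := lt_trans sk (_ : d + _ < d + e').
    have {k1} k1 : rnorm (x - s) < d + e' by apply: k1; rewrite ltrD2l hN.
    have : rnorm (x - s) ^+ 2 < (d + e') ^+ 2.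
      by rewrite ltr_pXn2r ?nnegrE ?rnorm_ge0// addr_ge0// ltW.
    move=> /lt_le_trans; apply.
    have : e' <= 1 by rewrite ge_min lexx.
    nra.
  have bm := b _ _ Sm Nm um; have bn := b _ _ Sn Nn un.
  have : e' <= e ^+ 2 / (8 * d + 8) by rewrite ge_min lexx orbT.
  rewrite ler_pdivlMr//; nra.
have Sh : S h.
  apply: Scl => e e0; have /cvg_rnorm_seqP/(_ _ e0)[N hN] := uh.
  by exists (u N); [case: (uP N)|exact: hN].
have hd : rnorm (x - h) <= d.
  apply: le_addeps => e e0.
  have [N1 h1] := eps_small _ (divr_gt0 e0 (ltr0n R 2)).
  have /cvg_rnorm_seqP/(_ _ (divr_gt0 e0 (ltr0n R 2)))[N2 h2] := uh.
  have [n n1 n2] : exists2 n, (N1 <= n)%N & (N2 <= n)%N.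
    by exists (maxn N1 N2); rewrite ?leq_maxl ?leq_maxr.
  have -> : x - h = (x - u n) - (h - u n) by rewrite opprB addrA subrK.
  apply: le_trans (ler_rnormD _ _) _; rewrite rnormN.
  have := h2 n n2; have := h1 n n1; have [_] := uP n.
  move: (rnorm _) (rnorm _) (_^-1) => A B C. lra.
exists h; split => // k Sk.
apply: (@first_order_eq0 _ _ (rnorm k ^+ 2)) => a.
have Sa : S (Num.conj a *: k + h) by exact: Slin.
have := le_trans hd (dle _ Sa).
rewrite -(@ler_pXn2r _ 2) ?nnegrE ?rnorm_ge0//.
have -> : x - (Num.conj a *: k + h) = (x - h) - Num.conj a *: k.
  by rewrite opprD [- _ - _]addrC addrA.
rewrite [rnorm (_ - _ *: _) ^+ 2]rnorm_sqrB hdotZr conjCK rnormZ rnorm_conj exprMn.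
by lra.
Qed.

Lemma projection_unique (S : set H) (x h h' : H) : closed_subspace S ->
  S h -> orthocompl S (x - h) -> S h' -> orthocompl S (x - h') -> h = h'.
Proof.
move=> [_ Slin _] Sh oh Sh' oh'; apply/eqP; rewrite -subr_eq0.
have Sd : S (h - h') by rewrite addrC -scaleN1r; exact: Slin.
have := oh' _ Sd; have := oh _ Sd => e1 e2.
have : hdot (h - h') (h - h') = 0.
  rewrite -{1}(subr_cancel x).
  by rewrite linearBl /= e1 e2 subrr.
rewrite hdotxx => /(congr1 (@complex.Re R)) /= /eqP.
by rewrite sqrf_eq0 rnorm_eq0.
Qed.

Lemma oprojP (S : set H) (x : H) : closed_subspace S ->
  S (oproj S x) /\ orthocompl S (x - oproj S x).
Proof.
move=> cS; have [h hP] := projection_exists x cS.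
rewrite /oproj.
exact: (@xgetPex _ 0 [set h | S h /\ orthocompl S (x - h)] (ex_intro _ h hP)).
Qed.

Lemma oproj_eq (S : set H) (x h : H) : closed_subspace S ->
  S h -> orthocompl S (x - h) -> oproj S x = h.
Proof.
move=> cS Sh oh; have [? ?] := oprojP x cS.
exact: (projection_unique cS _ _ Sh oh).
Qed.

Lemma oprojB (S : set H) (x y : H) : closed_subspace S ->
  oproj S (x - y) = oproj S x - oproj S y.
Proof.
move=> cS; have [? ox] := oprojP x cS; have [? oy] := oprojP y cS.
apply: oproj_eq => //.
  by case: cS => _ Slin _; rewrite addrC -scaleN1r; exact: Slin.
move=> k Sk; rewrite opprD addrACA -opprD.
by rewrite linearBl /= ox// oy// subrr.
Qed.

Lemma rnorm_oproj (S : set H) (x : H) : closed_subspace S ->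
  rnorm x ^+ 2 = rnorm (oproj S x) ^+ 2 + rnorm (x - oproj S x) ^+ 2.
Proof.
move=> cS; have [Sx ox] := oprojP x cS.
have := rnorm_sqrD (x - oproj S x) (oproj S x).
by rewrite subrK ox// mulr0 addr0 addrC.
Qed.

Lemma rnorm_oproj_le (S : set H) (x : H) : closed_subspace S ->
  rnorm (oproj S x) <= rnorm x /\ rnorm (x - oproj S x) <= rnorm x.
Proof.
move=> /(@rnorm_oproj S x) e.
rewrite -!(@ler_pXn2r _ 2 _ _ (rnorm x)) ?nnegrE ?rnorm_ge0// e.
by rewrite lerDl lerDr !sqr_ge0.
Qed.

End Hilbert.

Section BoundedOps.
Context (R : realType).
Implicit Types H K : hilbertType R.

Lemma bop_boundedW H K (T : bounded_op H K) :
  exists2 M : R, 0 < M & forall x, rnorm (T x) <= M * rnorm x.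
Proof.
have [M TM] := bop_bounded T; exists (`|M| + 1); first by rewrite ltr_wpDl.
move=> x; apply: le_trans (TM x) _; rewrite ler_wpM2r ?rnorm_ge0//.
by rewrite (le_trans (ler_norm _))// lerDl.
Qed.

Lemma op_ker_closed H K (T : bounded_op H K) :
  closed_subspace (op_ker (total_op T)).
Proof.
have [M M0 TM] := bop_boundedW T; split; first by split => //=; rewrite linear0.
- by move=> a x y [_ /= Tx] [_ /= Ty]; split => //=; rewrite linearP Tx Ty scaler0 addr0.
- move=> x h; split => //=; apply/eqP; rewrite -rnorm_eq0 eq_le rnorm_ge0 andbT.
  apply: (@le_mulgt0 _ _ M) => e /h[s [_ /= Ts] xs].
  rewrite -[T x]subr0 -Ts -linearB; apply: le_trans (TM _) _.
  by rewrite ler_pM2l// ltW.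
Qed.

(** Riesz representation of the functional [x |-> <T x, g>]: a vector
    orthogonal to its kernel represents it up to a scalar. This is what makes
    the adjoint everywhere defined. *)
Lemma riesz_adjoint H K (T : bounded_op H K) (g : K) :
  exists w, forall x, hdot (T x) g = hdot x w.
Proof.
pose S := [set x : H | hdot (T x) g = 0].
have [M M0 TM] := bop_boundedW T.
have cS : closed_subspace S.
  split; first by rewrite /S /= linear0 linear0l.
  - move=> a x y; rewrite /S /= => Sx Sy.
    by rewrite linearP linearDl /= hdotZl Sx Sy mulr0 addr0.
  - move=> x h; apply/eqP; rewrite -rnorm_eq0 eq_le rnorm_ge0 andbT.
    apply: (@le_mulgt0 _ _ (M * rnorm g)) => e /h[s Ss xs].
    rewrite -[hdot _ _]subr0 -Ss -linearBl -linearB.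
    apply: le_trans (rnorm_hdot _ _) _; rewrite mulrAC ler_wpM2r ?rnorm_ge0//.
    by apply: le_trans (TM _) _; rewrite ler_pM2l// ltW.
have [all0|/existsNP[x0 nS]] := pselect (forall x, hdot (T x) g = 0).
  by exists 0 => x; rewrite linear0r.
pose u := x0 - oproj S x0; have [Sp op] := oprojP x0 cS.
have Tu : hdot (T u) g = hdot (T x0) g by rewrite linearB linearBl /= Sp subr0.
have u0 : u != 0.
  by apply/negP => /eqP u0; move: Tu; rewrite u0 linear0 linear0l => /esym.
have uu : hdot u u != 0 by rewrite -hdot_norm expf_neq0// normr_eq0.
exists (Num.conj (hdot (T u) g / hdot u u) *: u) => x.
rewrite hdotZr conjCK.
(* [s] lies in the kernel of the functional, hence is orthogonal to [u]. *)
pose s := hdot (T u) g *: x - hdot (T x) g *: u.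
have Ss : S s.
  by rewrite /S /= /s linearB linearBl !linearZ_LR /= !hdotZl mulrC subrr.
have := hdot0C (op _ Ss); rewrite /s linearBl /= !hdotZl => /eqP.
rewrite subr_eq0 => /eqP e.
by rewrite mulrAC e mulfK.
Qed.

Lemma adjoint_total H K (T : bounded_op H K) (g : K) x :
  hdot (T x) g = hdot x (adjoint (total_op T) g).
Proof.
have [w wP] := riesz_adjoint T g; rewrite /adjoint /=.
set Q := [set h | _].
by have /(_ x) := @xgetPex _ 0 Q (ex_intro _ w (fun f _ => wP f)); apply.
Qed.

Lemma near_rnorm (V : normedModType R[i]) (x : V) (e : R) : 0 < e ->
  \forall y \near x, rnorm (x - y) < e.
Proof. by have /cvg_rnormP h : y @[y --> x] --> x by []; exact: h. Qed.

Lemma closure_rnorm (V : normedModType R[i]) (S : set V) (x : V) (e : R) :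
  closure S x -> 0 < e -> exists2 s, S s & rnorm (x - s) < e.
Proof. by move=> Sx /(near_rnorm x) /Sx [s [Ss xs]]; exists s. Qed.

Lemma dense_rnorm (V : normedModType R[i]) (S : set V) (x : V) (e : R) :
  dense S -> 0 < e -> exists2 s, S s & rnorm (x - s) < e.
Proof.
move=> dS e0; have : nbhs x [set y | rnorm (x - y) < e] := near_rnorm x e0.
rewrite nbhsE => -[U [Uo Ux] OB].
have [s [Us Ss]] := dS U (ex_intro _ x Ux) Uo.
by exists s => //; exact: OB.
Qed.

(** For [k] in the kernel, [<T (E k), g> = <k, E (T^* g)>], and [E (T^* g)] is a
    limit of values of the adjoint, all of which are orthogonal to the kernel. *)
Lemma ker_invariant H K (T : bounded_op H K) (E : bounded_op H H) :
  (forall f g, hdot (E f) g = hdot f (E g)) ->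
  E @` closure (op_range (adjoint (total_op T)))
    `<=` closure (op_range (adjoint (total_op T))) ->
  forall k, T k = 0 -> T (E k) = 0.
Proof.
move=> Esa Ecl k Tk; apply: hdot_eq0 => g.
rewrite adjoint_total Esa.
have cl : closure (op_range (adjoint (total_op T))) (E (adjoint (total_op T) g)).
  apply: Ecl; exists (adjoint (total_op T) g) => //; apply: subset_closure.
  exists g => //=; have [w wP] := riesz_adjoint T g.
  by exists w => f _; exact: wP.
apply/eqP; rewrite -rnorm_eq0 eq_le rnorm_ge0 andbT.
apply: (@le_mulgt0 _ _ (rnorm k)) => e e0.
have [_ [g' _ <-] ge] := closure_rnorm cl e0.
have k0 : hdot k (adjoint (total_op T) g') = 0.
  by rewrite -adjoint_total Tk linear0l.
rewrite -[hdot _ _]subr0 -k0 -linearBr; apply: le_trans (rnorm_hdot _ _) _.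
by rewrite ler_wpM2l ?rnorm_ge0// ltW.
Qed.

End BoundedOps.

(** * Integration against a complex measure *)

Section FinePartition.
Context d (T : measurableType d) (R : realType).
Implicit Types (D : set T) (F : nat -> set T).

Lemma mpartition_recr D n F : mpartition D n.+1 F ->
  [/\ mpartition (\bigcup_(i < n) F i) n F, measurable (\bigcup_(i < n) F i),
      measurable (F n), D = (\bigcup_(i < n) F i) `|` F n
    & [disjoint \bigcup_(i < n) F i & F n]].
Proof.
move=> [mF tF FD]; split=> //.
- by split => // i j /= iN jN; apply: tF; exact: ltnW.
- exact: bigcup_measurable.
- by rewrite -FD bigcup_mkord big_ord_recr /= -bigcup_mkord.
- apply/disj_setPS => x [[i /= iN Fi] FN].
  have iEN : i = n by apply: tF => //=; [exact: ltnW|exists x].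
  by move: iN; rewrite iEN ltnn.
Qed.

Lemma mpartition_measurable D n F : mpartition D n F -> measurable D.
Proof. by move=> [mF _ <-]; exact: bigcup_measurable. Qed.

Lemma mpartition_sub D n F i : mpartition D n F -> (i < n)%N -> F i `<=` D.
Proof. by move=> [_ _ <-] iN x Fx; exists i. Qed.

(** The cells are the preimages of a square grid of mesh [e] on the square
    [-N, N] x [-N, N] of values of [(g, h)]; cell number [i] has coordinates
    [i %/ K] and [i %% K]. *)
Lemma fine_partition D (g h : T -> R) (N e : R) : measurable D ->
  measurable_fun D g -> measurable_fun D h ->
  (forall x, D x -> `|g x| <= N) -> (forall x, D x -> `|h x| <= N) -> 0 < e ->
  exists n F, mpartition D n F /\
    forall i, (i < n)%N -> forall x y, F i x -> F i y ->
      `|g x - g y| <= e /\ `|h x - h y| <= e.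
Proof.
move=> mD mg mh gN hN e0.
pose K := (Num.truncn ((N + N) / e)).+1.
have K0 : (0 < K)%N by [].
pose I a := `[a%:R * e - N, a.+1%:R * e - N[%classic : set R.
pose F i := (D `&` g @^-1` I (i %/ K)%N) `&` (D `&` h @^-1` I (i %% K)%N).
have cellP (r : R) a : `|r| <= N -> I a r <-> Num.truncn ((r + N) / e) = a.
  move=> rN; have r0 : 0 <= (r + N) / e.
    by rewrite divr_ge0 ?(ltW e0)//; move: rN; rewrite ler_norml => /andP[]; lra.
  rewrite /I /= in_itv /= lerBlDr ltrBrDr -ler_pdivlMr// -ltr_pdivrMr//.
  by rewrite -truncn_eq//; split => /eqP.
have cell_lt (r : R) : `|r| <= N -> (Num.truncn ((r + N) / e) < K)%N.
  move=> rN; rewrite /K ltnS; apply: le_truncn.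
  by rewrite ler_pM2r ?invr_gt0// lerD2r (le_trans (ler_norm _)).
exists (K * K)%N, F; split; [split|].
- by move=> i; apply: measurableI; [apply: mg|apply: mh] => //; exact: measurable_itv.
- move=> i j _ _ [x [[[Dx gi] [_ hi]] [[_ gj] [_ hj]]]].
  rewrite (divn_eq i K) (divn_eq j K).
  move/(cellP _ _ (gN _ Dx)): gi => <-; move/(cellP _ _ (gN _ Dx)): gj => <-.
  by move/(cellP _ _ (hN _ Dx)): hi => <-; move/(cellP _ _ (hN _ Dx)): hj => <-.
- apply/seteqP; split => [x [i _ [[]]]//|x Dx].
  pose a := Num.truncn ((g x + N) / e); pose b := Num.truncn ((h x + N) / e).
  have aK : (a < K)%N by apply: cell_lt; exact: gN.
  have bK : (b < K)%N by apply: cell_lt; exact: hN.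
  exists (a * K + b)%N => /=.
    by rewrite -ltn_divLR// divnMDl// divn_small// addn0.
  rewrite /F divnMDl// (divn_small bK) addn0 modnMDl modn_small//.
  by split; split => //; rewrite /preimage /=; apply/cellP; rewrite ?gN ?hN.
- have cell a (r s : R) : I a r -> I a s -> `|r - s| <= e.
    rewrite /I /= !in_itv /= -natr1 mulrDl mul1r => /andP[h1 h2] /andP[h3 h4].
    by rewrite ler_norml; apply/andP; split; lra.
  by move=> i _ x y [[_ gx] [_ hx]] [[_ gy] [_ hy]]; split; apply: cell; eassumption.
Qed.

End FinePartition.

Section IntegralApprox.
Context d (T : measurableType d) (R : realType).

(** Integrals are compared with sums over partitions because those sums only
    involve values of the measure, where additivity is available. *)
Lemma Rintegral_approx (mu : {measure set T -> \bar R}) (D : set T) n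
    (F : nat -> set T) (h : T -> R) (c : nat -> R) (M e : R) :
  fin_num_fun mu -> mpartition D n F -> measurable_fun D h ->
  (forall x, D x -> `|h x| <= M) ->
  (forall i, (i < n)%N -> forall x, F i x -> `|h x - c i| <= e) ->
  `|\int[mu]_(x in D) h x - \sum_(i < n) c i * fine (mu (F i))|
    <= e * fine (mu D).
Proof.
move=> mufin; elim: n D => [|n ih] D pD mh hM hc.
  case: pD => _ _ <-; rewrite bigcup_mkord big_ord0 Rintegral_set0 big_ord0 subrr.
  by rewrite normr0 measure0 mulr0.
have [pD' mD' mF DE dF] := mpartition_recr pD.
set D' := \bigcup_(i < n) F i in pD' mD' DE dF *.
have mD : measurable D by exact: (mpartition_measurable pD).
have fin A : measurable A -> (mu A < +oo)%E.
  by move=> mA; rewrite -ge0_fin_numE ?mufin.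
have int A : measurable A -> A `<=` D -> mu.-integrable A (EFin \o h).
  move=> mA AD; apply: measurable_bounded_integrable => //.
  - exact: fin.
  - exact: (measurable_funS mD AD mh).
  - exists M; split; first exact: num_real.
    by move=> x Mx y /= /AD/hM /le_trans; apply; exact: ltW.
have D'D : D' `<=` D by rewrite DE; exact: subsetUl.
have FD : F n `<=` D by rewrite DE; exact: subsetUr.
rewrite DE Rintegral_setU//; last by rewrite -DE; exact: int.
rewrite measureU//; last by apply/disj_set2P.
rewrite fineD ?mufin// big_ord_recr /= mulrDr opprD addrACA.
apply: le_trans (ler_normD _ _) _; apply: lerD.
  apply: ih => //; first exact: (measurable_funS mD D'D mh).
    by move=> x /D'D; exact: hM.
  by move=> i iN; apply: hc; exact: ltnW.
have icst r : mu.-integrable (F n) (EFin \o cst r).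
  by apply: measurable_bounded_integrable => //; [exact: fin|exact: bounded_cst].
have lo : (c n - e) * fine (mu (F n)) <= \int[mu]_(x in F n) h x.
  rewrite -Rintegral_cst//; apply: le_Rintegral => //; first exact: icst.
    exact: int.
  by move=> x /(hc n (ltnSn n)); rewrite ler_norml => /andP[]; lra.
have up : \int[mu]_(x in F n) h x <= (c n + e) * fine (mu (F n)).
  rewrite -Rintegral_cst//; apply: le_Rintegral => //; first exact: int.
    exact: icst.
  by move=> x /(hc n (ltnSn n)); rewrite ler_norml => /andP[]; lra.
by rewrite ler_norml; apply/andP; split; lra.
Qed.

Section Charge.
Variables (nu : {charge set T -> \bar R}) (B : R).
Hypothesis nuB : forall A, measurable A -> `|fine (nu A)| <= B.

Let pos := jordan_pos (svalP (hahn_sets nu)).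
Let neg := jordan_neg (svalP (hahn_sets nu)).

Let charge_sets := svalP (hahn_sets nu).

Lemma jordan_fine A : measurable A ->
  fine (nu A) = fine (pos A) - fine (neg A).
Proof.
move=> mA; rewrite (jordan_decomp charge_sets mA) /cadd /= cscaleN1.
by rewrite fineD ?fin_num_measure// ?fin_numN ?fin_num_measure// fineN.
Qed.

Lemma jordan_le A : measurable A ->
  0 <= fine (pos A) <= B /\ 0 <= fine (neg A) <= B.
Proof.
move=> mA; rewrite !fine_ge0//=.
have [[mP _] [mN _] _ _] := charge_sets.
split.
- rewrite /pos jordan_posE cjordan_posE /crestr0 mem_set// /crestr.
  by apply: le_trans (ler_norm _) (nuB _); exact: measurableI.
- rewrite /neg jordan_negE cjordan_negE /crestr0 mem_set// /crestr fineN.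
  apply: le_trans (ler_norm _) _; rewrite normrN; apply: nuB.
  exact: measurableI.
Qed.

Lemma charge_integral_approx (D : set T) n (F : nat -> set T) (h : T -> R)
    (c : nat -> R) (M e : R) : 0 <= e ->
  mpartition D n F -> measurable_fun D h -> (forall x, D x -> `|h x| <= M) ->
  (forall i, (i < n)%N -> forall x, F i x -> `|h x - c i| <= e) ->
  `|charge_integral nu D h - \sum_(i < n) c i * fine (nu (F i))| <= 2 * B * e.
Proof.
move=> e0 pD mh hM hc.
have mD := mpartition_measurable pD.
have := Rintegral_approx (fin_num_measure pos) pD mh hM hc.
have := Rintegral_approx (fin_num_measure neg) pD mh hM hc.
rewrite /charge_integral -/pos -/neg.
have -> : \sum_(i < n) c i * fine (nu (F i)) =
    \sum_(i < n) c i * fine (pos (F i)) - \sum_(i < n) c i * fine (neg (F i)).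
  rewrite -sumrB; apply: eq_bigr => i _; rewrite jordan_fine ?mulrBr//.
  by case: pD.
have [/andP[p0 pB] /andP[n0 nB]] := jordan_le mD.
have := ler_wpM2l e0 pB; have := ler_wpM2l e0 nB.
rewrite !ler_norml => h1 h2 /andP[h3 h4] /andP[h5 h6].
by apply/andP; split; lra.
Qed.

(** Each part of the Jordan decomposition has total mass at most [B]. *)
Lemma charge_sum_le (D : set T) n (F : nat -> set T) : mpartition D n F ->
  \sum_(i < n) `|fine (nu (F i))| <= 2 * B.
Proof.
move=> pD; have mF i : measurable (F i) by case: pD.
have mD := mpartition_measurable pD.
have sumE (mu : {finite_measure set T -> \bar R}) :
    \sum_(i < n) fine (mu (F i)) = fine (mu D).
  (* Finite additivity, read off the exact approximation of the constant 1. *)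
  have h1 x : D x -> `|cst 1 x| <= 1 :> R by rewrite normr1.
  have h2 i : (i < n)%N -> forall x, F i x -> `|cst 1 x - cst 1 i| <= 0 :> R.
    by move=> _ x _; rewrite subrr normr0.
  have := Rintegral_approx (fin_num_measure mu) pD (measurable_cst (1 : R)) h1 h2.
  rewrite mul0r normr_le0 subr_eq0 Rintegral_cst// mul1r => /eqP ->.
  by apply: eq_bigr => i _; rewrite mul1r.
apply: (@le_trans _ _ (\sum_(i < n) (fine (pos (F i)) + fine (neg (F i))))).
  apply: ler_sum => i _; rewrite jordan_fine//.
  apply: le_trans (ler_normB _ _) _.
  by rewrite !ger0_norm// fine_ge0.
rewrite big_split /= !sumE.
by have [/andP[_ +] /andP[_ +]] := jordan_le mD; lra.
Qed.

Lemma charge_integral_null (D D' : set T) (h : T -> R) (M : R) :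
  measurable D -> measurable D' -> D `<=` D' ->
  measurable_fun D' h -> (forall x, D x -> `|h x| <= M) ->
  (forall A, measurable A -> A `<=` ~` D -> nu A = 0%E) ->
  charge_integral nu D' h = charge_integral nu D h.
Proof.
move=> mD mD' DD' mh hM nu0.
have mDC : measurable (D' `\` D) by exact: measurableD.
have DC A : (D' `\` D) `&` A `<=` ~` D by move=> x [[_ +] _].
have [[mP _] [mN _] _ _] := charge_sets.
have p0 : pos (D' `\` D) = 0%E.
  rewrite /pos jordan_posE cjordan_posE /crestr0 mem_set// /crestr nu0//.
  exact: measurableI.
have n0 : neg (D' `\` D) = 0%E.
  rewrite /neg jordan_negE cjordan_negE /crestr0 mem_set// /crestr nu0 ?oppe0//.
  exact: measurableI.
have key (mu : {finite_measure set T -> \bar R}) : mu (D' `\` D) = 0%E ->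
    \int[mu]_(x in D') h x = \int[mu]_(x in D) h x.
  move=> mu0.
  have DK : D' `\` (D' `\` D) = D by rewrite setDD setIidr.
  have mhD : measurable_fun D h by exact: (measurable_funS mD' _ mh).
  have i1 : mu.-integrable D (EFin \o h).
    apply: measurable_bounded_integrable => //.
    - by rewrite -ge0_fin_numE ?fin_num_measure.
    - exists M; split; first exact: num_real.
      by move=> x Mx y /= /hM /le_trans; apply; exact: ltW.
  have i3 : mu.-integrable D' (EFin \o h).
    rewrite (negligible_integrable mDC)// ?DK//.
    exact/measurable_EFinP.
  by rewrite /Rintegral (negligible_integral mDC)// DK.
by rewrite /charge_integral -/pos -/neg !key.
Qed.

End Charge.
End IntegralApprox.

Section ComplexApprox.
Context d (T : measurableType d) (R : realType).
Variable nu : complex_measure T R.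

(** Measurability is asked of the two coordinates, which are what an integral
    against a complex measure integrates. *)
Definition bmeasurable (D : set T) (phi : T -> R[i]) : Prop :=
  [/\ measurable_fun D (fun x => complex.Re (phi x)),
      measurable_fun D (fun x => complex.Im (phi x))
    & exists M : R, forall x, D x -> rnorm (phi x) <= M].

(** The constants [c i] are values of [phi], or [0] on empty cells, so that they
    inherit constraints such as a nonnegative real part. *)
Lemma bmeasurable_partition (D : set T) (phi : T -> R[i]) (e : R) :
  measurable D -> bmeasurable D phi -> 0 < e ->
  exists n F (c : nat -> R[i]), mpartition D n F
   /\ (forall i, (i < n)%N -> forall x, F i x -> rnorm (phi x - c i) <= e)
   /\ (forall i, (exists2 x, F i x & c i = phi x) \/ F i = set0 /\ c i = 0).
Proof.
move=> mD [mRe mIm [M phiM]] e0.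
have e2 : 0 < e / 2 by rewrite divr_gt0.
have bRe x : D x -> `|complex.Re (phi x)| <= M.
  by move=> /phiM; apply: le_trans; exact: ler_norm_Re.
have bIm x : D x -> `|complex.Im (phi x)| <= M.
  by move=> /phiM; apply: le_trans; exact: ler_norm_Im.
have [n [F [pF hF]]] := fine_partition mD mRe mIm bRe bIm e2.
have sel i : exists c : R[i],
    (exists2 x, F i x & c = phi x) \/ F i = set0 /\ c = 0.
  have [->|/set0P[x Fx]] := eqVneq (F i) set0; first by exists 0; right.
  by exists (phi x); left; exists x.
have [c cP] := choice sel.
exists n, F, c; split => //; split => // i iN x Fx.
have [[y Fy ->]|[F0 _]] := cP i; last by rewrite F0 in Fx.
have [h1 h2] := hF i iN x y Fx Fy.
apply: le_trans (rnorm_leD _) _; rewrite complexReD complexImD complexReN complexImN; lra.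
Qed.

Section Bounded.
Variable B : R.
Hypothesis nuB : forall A, measurable A -> rnorm (nu A) <= B.

(** The two coordinates of the integral are made of four integrals against a
    real charge, and each of them has the error [2 * B * e]. *)
Lemma cintegral_approx (D : set T) n (F : nat -> set T) (phi : T -> R[i])
    (c : nat -> R[i]) (e : R) : 0 <= e ->
  mpartition D n F -> bmeasurable D phi ->
  (forall i, (i < n)%N -> forall x, F i x -> rnorm (phi x - c i) <= e) ->
  rnorm (cintegral nu D phi - \sum_(i < n) c i * nu (F i)) <= 8 * B * e.
Proof.
move=> e0 pD [mRe mIm [M phiM]] hc.
have MRe x : D x -> `|complex.Re (phi x)| <= M.
  by move=> /phiM; apply: le_trans; exact: ler_norm_Re.
have MIm x : D x -> `|complex.Im (phi x)| <= M.
  by move=> /phiM; apply: le_trans; exact: ler_norm_Im.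
have cRe i : (i < n)%N -> forall x, F i x ->
    `|complex.Re (phi x) - complex.Re (c i)| <= e.
  move=> iN x Fx; apply: le_trans (hc i iN x Fx).
  by rewrite -complexReN -complexReD; exact: ler_norm_Re.
have cIm i : (i < n)%N -> forall x, F i x ->
    `|complex.Im (phi x) - complex.Im (c i)| <= e.
  move=> iN x Fx; apply: le_trans (hc i iN x Fx).
  by rewrite -complexImN -complexImD; exact: ler_norm_Im.
have reB A : measurable A -> `|fine (cmeas_re nu A)| <= B.
  by move=> /nuB; apply: le_trans; exact: ler_norm_Re.
have imB A : measurable A -> `|fine (cmeas_im nu A)| <= B.
  by move=> /nuB; apply: le_trans; exact: ler_norm_Im.
have := charge_integral_approx reB e0 pD mRe MRe cRe.
have := charge_integral_approx imB e0 pD mIm MIm cIm.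
have := charge_integral_approx imB e0 pD mRe MRe cRe.
have := charge_integral_approx reB e0 pD mIm MIm cIm.
set a1 := \sum_(i < n) _; set a2 := \sum_(i < n) _.
set a3 := \sum_(i < n) _; set a4 := \sum_(i < n) _ => h1 h2 h3 h4.
have sE : \sum_(i < n) c i * nu (F i) = (a4 - a3) +i* (a2 + a1).
  rewrite /a1 /a2 /a3 /a4 -sumrB -big_split /= /cmeas_re /cmeas_im /=.
  elim/big_ind3 : _ => [//|x1 x2 x3 y1 y2 y3 -> ->//|i _].
  by apply/eqP; rewrite eq_complex complexReM complexImM /= !eqxx.
apply: le_trans (rnorm_leD _) _.
rewrite complexReD complexImD complexReN complexImN sE /cintegral /=.
have distB (x y a b K M' : R) : `|x - a| <= K -> `|y - b| <= M' ->
    `|x - y - (a - b)| <= K + M'.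
  move=> h h'; rewrite opprD addrACA -opprD.
  exact: le_trans (ler_normB _ _) (lerD h h').
have distD (x y a b K M' : R) : `|x - a| <= K -> `|y - b| <= M' ->
    `|x + y - (a + b)| <= K + M'.
  move=> h h'; rewrite opprD addrACA.
  exact: le_trans (ler_normD _ _) (lerD h h').
have -> : 8 * B * e = (2 * B * e + 2 * B * e) + (2 * B * e + 2 * B * e) by ring.
apply: lerD.
  exact: distB.
exact: distD.
Qed.

Lemma cintegral_le_const (D : set T) (phi : T -> R[i]) (e : R) :
  measurable D -> bmeasurable D phi -> 0 <= e ->
  (forall x, D x -> rnorm (phi x) <= e) ->
  rnorm (cintegral nu D phi) <= 8 * B * e.
Proof.
move=> mD bphi e0 he.
have pD : mpartition D 1 (fun=> D).
  split => //; first by move=> i j /=; case: i j => [|//] [].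
  by apply/seteqP; split => [x [i _]//|x Dx]; exists 0%N.
have h i : (i < 1)%N -> forall x, D x -> rnorm (phi x - cst 0 i) <= e.
  by move=> _ x Dx; rewrite subr0 he.
by have := cintegral_approx e0 pD bphi h; rewrite big_ord1 mul0r subr0.
Qed.

Lemma cintegral_null (D D' : set T) (phi : T -> R[i]) :
  measurable D -> measurable D' -> D `<=` D' ->
  measurable_fun D' (fun x => complex.Re (phi x)) ->
  measurable_fun D' (fun x => complex.Im (phi x)) ->
  (exists M : R, forall x, D x -> rnorm (phi x) <= M) ->
  (forall A, measurable A -> A `<=` ~` D -> nu A = 0) ->
  cintegral nu D' phi = cintegral nu D phi.
Proof.
move=> mD mD' DD' mRe mIm [M bD] nu0.
have bRe x : D x -> `|complex.Re (phi x)| <= M.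
  by move=> /bD; apply: le_trans; exact: ler_norm_Re.
have bIm x : D x -> `|complex.Im (phi x)| <= M.
  by move=> /bD; apply: le_trans; exact: ler_norm_Im.
have re0 A : measurable A -> A `<=` ~` D -> cmeas_re nu A = 0%E.
  by move=> mA AD; rewrite /cmeas_re nu0.
have im0 A : measurable A -> A `<=` ~` D -> cmeas_im nu A = 0%E.
  by move=> mA AD; rewrite /cmeas_im nu0.
rewrite /cintegral /= !(charge_integral_null mD mD' DD' mRe bRe)//.
by rewrite !(charge_integral_null mD mD' DD' mIm bIm).
Qed.

(** A measure carried by [D] does not see the integrand outside [D]; there
    [phi] is nearly the constant [c]. *)
Lemma cintegral_near_cst (D : set T) (phi : T -> R[i]) (c : R[i]) (e : R) :
  measurable D -> measurable_fun setT (fun x => complex.Re (phi x)) ->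
  measurable_fun setT (fun x => complex.Im (phi x)) ->
  (forall A, measurable A -> A `<=` ~` D -> nu A = 0) -> 0 <= e ->
  (forall x, D x -> rnorm (phi x - c) <= e) ->
  rnorm (cintegral nu setT phi - c * nu D) <= 8 * B * e.
Proof.
move=> mD mRe mIm nu0 e0 he.
have bD x : D x -> rnorm (phi x) <= rnorm c + e.
  move=> /he h; rewrite -(subrK c (phi x)); apply: le_trans (ler_rnormD _ _) _.
  by rewrite addrC lerD2l.
have -> : cintegral nu setT phi = cintegral nu D phi.
  by apply: cintegral_null => //; eexists; exact: bD.
have pD : mpartition D 1 (fun=> D).
  split => //; first by move=> i j /=; case: i j => [|//] [].
  by apply/seteqP; split => [x [i _]//|x Dx]; exists 0%N.
have bphi : bmeasurable D phi.
  split; [exact: measurable_funS mRe|exact: measurable_funS mIm|].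
  by eexists; exact: bD.
have h i : (i < 1)%N -> forall x, D x -> rnorm (phi x - cst c i) <= e.
  by move=> _ x Dx; rewrite he.
by have := cintegral_approx e0 pD bphi h; rewrite big_ord1.
Qed.

Lemma tv_le_bound A : (tv nu A <= (4 * B)%:E)%E.
Proof.
have B0 : 0 <= B by apply: le_trans (rnorm_ge0 _) (nuB measurable0).
apply: tv_le => [|n F pA]; first by rewrite lee_fin mulr_ge0.
have mF i : measurable (F i) by case: pA.
rewrite sumEFin lee_fin big_mkord.
have reB X : measurable X -> `|fine (cmeas_re nu X)| <= B.
  by move=> /nuB; apply: le_trans; exact: ler_norm_Re.
have imB X : measurable X -> `|fine (cmeas_im nu X)| <= B.
  by move=> /nuB; apply: le_trans; exact: ler_norm_Im.
apply: (@le_trans _ _ (\sum_(i < n)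
    (`|fine (cmeas_re nu (F i))| + `|fine (cmeas_im nu (F i))|))).
  by apply: ler_sum => i _; exact: rnorm_leD.
rewrite big_split /=.
have := charge_sum_le reB pA; have := charge_sum_le imB pA.
by lra.
Qed.

Lemma tv_fin_num : fin_num_fun (tv nu).
Proof.
move=> A mA; rewrite ge0_fin_numE ?tv_ge0//.
by rewrite (le_lt_trans (tv_le_bound _))// ltry.
Qed.

Lemma rnorm_le_tv A : measurable A -> rnorm (nu A) <= fine (tv nu A).
Proof.
move=> mA; rewrite -lee_fin fineK ?tv_fin_num//.
have pA : mpartition A 1 (fun=> A).
  split => //; first by move=> i j /=; case: i j => [|//] [].
  by apply/seteqP; split => [x [i _]//|x Dx]; exists 0%N.
by have := tv_ge nu pA; rewrite big_nat1.
Qed.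

Lemma rnorm_bmeasurable D (phi : T -> R[i]) : bmeasurable D phi ->
  measurable_fun D (fun x => rnorm (phi x)).
Proof.
move=> [mRe mIm _].
have -> : (fun x => rnorm (phi x)) =
    (fun x => Num.sqrt (complex.Re (phi x) ^+ 2 + complex.Im (phi x) ^+ 2)).
  by apply/funext => x; rewrite -rnorm_sqrE sqrtr_sqr ger0_norm ?rnorm_ge0.
apply: measurableT_comp.
  by apply: continuous_measurable_fun; exact: sqrt_continuous.
by apply: measurable_funD; exact: measurable_funX.
Qed.

(** The approximating sums satisfy the bound cell by cell, since [|nu (F i)|] is
    at most the variation of [F i], and both sides converge with the mesh. *)
Lemma rnorm_cintegral_le (D : set T) (phi : T -> R[i]) :
  measurable D -> bmeasurable D phi ->
  rnorm (cintegral nu D phi) <= \int[tv nu]_(x in D) rnorm (phi x).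
Proof.
move=> mD bphi; have B0 : 0 <= B by apply: le_trans (rnorm_ge0 _) (nuB measurable0).
apply: le_addeps => e e0.
(* The mesh costs [8 B] times itself on the left and [4 B] on the right. *)
have e'0 : 0 < e / (12 * B + 1) by rewrite divr_gt0//; lra.
have [n [F [c [pD [hc _]]]]] := bmeasurable_partition mD bphi e'0.
have [mRe mIm [M phiM]] := bphi.
have bM x : D x -> `|rnorm (phi x)| <= M.
  by move=> /phiM; rewrite ger0_norm// rnorm_ge0.
have hc' i : (i < n)%N -> forall x, F i x ->
    `|rnorm (phi x) - rnorm (c i)| <= e / (12 * B + 1).
  by move=> iN x Fx; apply: le_trans (ler_rnormB _ _) _; exact: hc.
have h1 := cintegral_approx (ltW e'0) pD bphi hc.
have h2 := Rintegral_approx tv_fin_num pD (rnorm_bmeasurable bphi) bM hc'.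
have h3 : rnorm (\sum_(i < n) c i * nu (F i)) <=
    \sum_(i < n) rnorm (c i) * fine (tv nu (F i)).
  apply: le_trans (ler_rnorm_sum _ _) _; apply: ler_sum => i _.
  rewrite rnormM ler_wpM2l ?rnorm_ge0// rnorm_le_tv//.
  by case: pD.
have tvD : fine (tv nu D) <= 4 * B.
  by rewrite -lee_fin fineK ?tv_fin_num// tv_le_bound.
have := ler_wpM2l (ltW e'0) tvD.
have := ler_rnormD (cintegral nu D phi - \sum_(i < n) c i * nu (F i))
  (\sum_(i < n) c i * nu (F i)).
rewrite subrK; move: h2; rewrite ler_norml => /andP[h2 _].
have eE : e = e / (12 * B + 1) * (12 * B + 1).
  by rewrite divfK//; apply: lt0r_neq0; lra.
by move: (e / _) e'0 eE h1 h2 h3 => e' e'0 -> h1 h2 h3 h4 h5; lra.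
Qed.

Lemma rnorm_cintegral_le_tv (D : set T) (phi : T -> R[i]) :
  measurable D -> bmeasurable D phi ->
  ((rnorm (cintegral nu D phi))%:E <= \int[tv nu]_(x in D) (rnorm (phi x))%:E)%E.
Proof.
move=> mD bphi; have mphi := rnorm_bmeasurable bphi.
have iphi : (tv nu).-integrable D (EFin \o (fun x => rnorm (phi x))).
  apply: measurable_bounded_integrable => //.
    by rewrite -ge0_fin_numE ?tv_ge0// tv_fin_num.
  have [_ _ [M hM]] := bphi; exists M; split; first exact: num_real.
  move=> x Mx y /= /hM yM; rewrite ger0_norm ?rnorm_ge0//.
  by apply: le_trans yM _; exact: ltW.
rewrite -[leRHS]fineK; last exact: integrable_fin_num iphi.
by rewrite lee_fin; exact: rnorm_cintegral_le.
Qed.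

End Bounded.
End ComplexApprox.

(** Besides linearity in the measure, this gives (with [a = 0]) that the integral
    depends only on the values on measurable sets, although a complex measure is
    a function on all sets. *)
Lemma cintegral_linear d (T : measurableType d) (R : realType) (B : R) (a : R[i])
    (nu nu1 nu2 : complex_measure T R) (D : set T) (phi : T -> R[i]) :
  (forall A, measurable A -> rnorm (nu A) <= B) ->
  (forall A, measurable A -> rnorm (nu1 A) <= B) ->
  (forall A, measurable A -> rnorm (nu2 A) <= B) ->
  (forall A, measurable A -> nu A = nu1 A + a * nu2 A) ->
  measurable D -> bmeasurable D phi ->
  cintegral nu D phi = cintegral nu1 D phi + a * cintegral nu2 D phi.
Proof.
move=> B0 B1 B2 nuE mD bphi; apply/eqP; rewrite -subr_eq0 -rnorm_eq0.
rewrite eq_le rnorm_ge0 andbT.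
apply: (@le_mulgt0 _ _ (16 * B + rnorm a * (8 * B))) => e e0.
have [n [F [c [pD [hc _]]]]] := bmeasurable_partition mD bphi e0.
have h0 := cintegral_approx B0 (ltW e0) pD bphi hc.
have h1 := cintegral_approx B1 (ltW e0) pD bphi hc.
have h2 := cintegral_approx B2 (ltW e0) pD bphi hc.
have sE : \sum_(i < n) c i * nu (F i) =
    \sum_(i < n) c i * nu1 (F i) + a * \sum_(i < n) c i * nu2 (F i).
  rewrite mulr_sumr -big_split /=; apply: eq_bigr => i _.
  by rewrite nuE ?mulrDr ?[a * (_ * _)]mulrCA//; case: pD.
rewrite {}sE in h0; move: h0 h1 h2.
set s1 := \sum_(i < n) c i * nu1 (F i); set s2 := \sum_(i < n) c i * nu2 (F i).
move=> h0 h1 h2.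
set x := cintegral nu D phi in h0 *.
set x1 := cintegral nu1 D phi in h1 *; set x2 := cintegral nu2 D phi in h2 *.
have -> : x - (x1 + a * x2) =
    (x - (s1 + a * s2)) - (x1 - s1) - a * (x2 - s2) by ring.
apply: le_trans (ler_rnormD _ _) _; rewrite rnormN rnormM.
apply: le_trans (lerD (ler_rnormD _ _) (lexx _)) _; rewrite rnormN.
by have := ler_wpM2l (rnorm_ge0 a) h2; lra.
Qed.

Lemma tv_null d (T : measurableType d) (R : realType)
    (nu : complex_measure T R) (N : set T) :
  (forall X, measurable X -> X `<=` N -> nu X = 0) -> tv nu N = 0%E.
Proof.
move=> nu0; apply/eqP; rewrite eq_le tv_ge0 andbT.
apply: tv_le => // n F pN; rewrite big_nat big1// => i /andP[_ iN].
have [mF _ _] := pN; rewrite nu0 ?rnorm0//.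
exact: mpartition_sub pN iN.
Qed.

(** * The Borel plane and the complex exponential *)

Section ComplexBorel.
Context (R : realType).
Implicit Types (z w : R[i]) (U : set R[i]).

Lemma open_rnormP U :
  (forall z, U z -> exists2 e : R, 0 < e & forall w, rnorm (z - w) < e -> U w) ->
  open U.
Proof.
move=> h; rewrite (_ : U = interior U); first exact: open_interior.
apply/seteqP; split; last exact: interior_subset.
move=> z Uz; have [e e0 eU] := h z Uz.
by apply: filterS (near_rnorm z e0) => w; exact: eU.
Qed.

Lemma Cborel_open U : open U -> measurable (U : set (Cborel R)).
Proof. by move=> oU; exact: sub_sigma_algebra. Qed.

Lemma Cborel_measurable_lipschitz (f : R[i] -> R) :
  (forall z w, `|f z - f w| <= rnorm (z - w)) ->
  measurable_fun setT (f : Cborel R -> R).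
Proof.
move=> lf; apply: (measurability _ (RGenOpens.measurableE R)).
move=> _ [_ [a [b ->]] <-]; rewrite setTI; apply: Cborel_open.
apply: open_rnormP => z /=; rewrite in_itv /= => /andP[az zb].
exists (Num.min (f z - a) (b - f z)); first by rewrite lt_min !subr_gt0 az.
move=> w; rewrite lt_min in_itv /= => /andP[h1 h2].
have := lf z w; rewrite ler_norml => /andP[h3 h4].
by apply/andP; split; lra.
Qed.

Definition disk z (r : R) : set R[i] := [set w | rnorm (w - z) < r].

Lemma disk_measurable z r : measurable (disk z r : set (Cborel R)).
Proof.
apply: Cborel_open; apply: open_rnormP => w; rewrite /disk /= => wr.
exists (r - rnorm (w - z)); first by rewrite subr_gt0.
move=> y; rewrite ltrBrDr rnormBC => yr; apply: le_lt_trans yr.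
have -> : y - z = (y - w) + (w - z) by rewrite addrA subrK.
exact: ler_rnormD.
Qed.

Lemma Re_measurable : measurable_fun setT (fun z : Cborel R => complex.Re z).
Proof.
apply: (@Cborel_measurable_lipschitz (@complex.Re R)) => z w.
by rewrite -complexReN -complexReD; exact: ler_norm_Re.
Qed.

Lemma Im_measurable : measurable_fun setT (fun z : Cborel R => complex.Im z).
Proof.
apply: (@Cborel_measurable_lipschitz (@complex.Im R)) => z w.
by rewrite -complexImN -complexImD; exact: ler_norm_Im.
Qed.

Lemma rnorm_measurable : measurable_fun setT (fun z : Cborel R => rnorm (z : R[i])).
Proof.
apply: (@Cborel_measurable_lipschitz (fun z : R[i] => rnorm z)) => z w.
exact: ler_rnormB.
Qed.

Lemma set1_measurable z : measurable ([set z] : set (Cborel R)).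
Proof.
rewrite -[X in measurable X]setCK; apply: measurableC.
apply: Cborel_open; apply: open_rnormP => w /= wz.
exists (rnorm (w - z)).
  rewrite lt_neqAle rnorm_ge0 eq_sym rnorm_eq0 subr_eq0 andbT.
  by apply/eqP.
by move=> y h yz; rewrite yz ltxx in h.
Qed.

Lemma halfplane_measurable (c : R) :
  measurable ([set z | complex.Re z < c] : set (Cborel R)).
Proof.
apply: Cborel_open; apply: open_rnormP => z /= zc.
exists (c - complex.Re z); first by rewrite subr_gt0.
move=> w; rewrite ltrBrDr; apply: le_lt_trans.
rewrite rnormBC -lerBlDr -complexReN -complexReD.
exact: le_trans (ler_norm _) (ler_norm_Re _).
Qed.

End ComplexBorel.

Section ComplexExp.
Context (R : realType).
Implicit Types z w : R[i].

Lemma rnorm_cexp z : rnorm (cexp z) = expR (complex.Re z).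
Proof.
rewrite -[LHS]ger0_norm ?rnorm_ge0// -sqrtr_sqr rnorm_sqrE /=.
by rewrite !exprMn -mulrDr cos2Dsin2 mulr1 sqrtr_sqr ger0_norm ?expR_ge0.
Qed.

Lemma cexp0 : cexp (0 : R[i]) = 1.
Proof. by rewrite /cexp /= expR0 cos0 sin0 mulr1 mulr0. Qed.

Lemma cexpD z w : cexp (z + w) = cexp z * cexp w.
Proof.
apply/eqP; rewrite eq_complex complexReM complexImM /= complexReD complexImD.
rewrite expRD cosD sinD; apply/andP; split; apply/eqP; ring.
Qed.

Lemma cexpMn z n : cexp (z *+ n) = cexp z ^+ n.
Proof.
by elim: n => [|n ih]; rewrite ?mulr0n ?cexp0// mulrS cexpD ih exprS.
Qed.

Lemma is_derive_eps (f : R -> R) (f' e : R) : is_derive (0 : R) 1 f f' -> 0 < e ->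
  \forall t \near (0 : R)^'+, `|f t - f 0 - t * f'| <= e * t.
Proof.
move=> [df dE] e0; rewrite /derivable in df.
have /cvgrPdist_le/(_ _ e0) := df; rewrite -[lim _]/('D_1 f 0) dE.
rewrite !near_withinE; apply: filterS => t ht t0.
have {ht} := ht (lt0r_neq0 t0); rewrite /= addr0 => ht.
have -> : f t - f 0 - t * f' = - (t * (f' - t^-1 * (f t - f 0))).
  by field; exact: lt0r_neq0.
rewrite normrN normrM gtr0_norm// mulrC ler_pM2r//.
move: ht; rewrite /GRing.scale /= mulr1; exact.
Qed.

(** Cuts an interval of length [c] into equal steps, short enough for an estimate
    that holds near zero. *)
Lemma near_right_step (Q : R -> Prop) (c : R) : 0 < c ->
  (\forall t \near (0 : R)^'+, Q t) -> exists n : nat, Q (c / n.+1%:R).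
Proof.
move=> c0; rewrite near_withinE => /nbhs_ballP[e /= e0 eQ].
have /cvgrPdist_lt/(_ _ (divr_gt0 e0 c0))[N _ hN] := @cvg_harmonic R.
exists N; apply: eQ; last by rewrite divr_gt0.
have := hN N (leqnn N); rewrite /= /ball /= !sub0r !normrN.
by rewrite normrM (gtr0_norm c0) ltr_pdivlMr// mulrC.
Qed.

Lemma cexp_first_order z (e : R) : 0 < e ->
  \forall t \near (0 : R)^'+, rnorm (cexp (t%:C * z) - 1 - t%:C * z) <= e * t.
Proof.
move=> e0; have e2 : 0 < e / 2 by rewrite divr_gt0.
set x := complex.Re z; set y := complex.Im z.
pose f t := expR (t * x) * cos (t * y); pose g t := expR (t * x) * sin (t * y).
have df : is_derive (0 : R) 1 f x.
  apply: is_derive_eq; rewrite !mul0r expR0 sin0 cos0 /GRing.scale /=; ring.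
have dg : is_derive (0 : R) 1 g y.
  apply: is_derive_eq; rewrite !mul0r expR0 sin0 cos0 /GRing.scale /=; ring.
have hf := is_derive_eps df e2; have hg := is_derive_eps dg e2.
near=> t.
have : `|f t - f 0 - t * x| <= e / 2 * t by near: t.
have : `|g t - g 0 - t * y| <= e / 2 * t by near: t.
rewrite /f /g !mul0r expR0 cos0 sin0 mulr1 mulr0 subr0 => h1 h2.
apply: le_trans (rnorm_leD _) _.
rewrite !complexReD !complexImD !complexReN !complexImN !complexReM !complexImM /=.
rewrite -/x -/y !mul0r !subr0 !addr0.
by rewrite complexReM complexImM /= !mul0r subr0 addr0; lra.
Unshelve. all: by end_near. Qed.

(** The exponential is 1-Lipschitz on the left half-plane: split [z] and [w]
    into [n] equal steps, compare the powers of two numbers of modulus at most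
    one, and let [n] grow. *)
Lemma cexp_lipschitz z w : complex.Re z <= 0 -> complex.Re w <= 0 ->
  rnorm (cexp z - cexp w) <= rnorm (z - w).
Proof.
move=> z0 w0; apply: le_addeps => e e0; have e2 : 0 < e / 2 by rewrite divr_gt0.
have [n nz nw] : exists2 n,
    rnorm (cexp ((n.+1%:R^-1)%:C * z) - 1 - (n.+1%:R^-1)%:C * z)
      <= e / 2 * n.+1%:R^-1
  & rnorm (cexp ((n.+1%:R^-1)%:C * w) - 1 - (n.+1%:R^-1)%:C * w)
      <= e / 2 * n.+1%:R^-1.
  have hz := cexp_first_order z e2; have hw := cexp_first_order w e2.
  have hzw : \forall t \near (0 : R)^'+,
      rnorm (cexp (t%:C * z) - 1 - t%:C * z) <= e / 2 * t /\
      rnorm (cexp (t%:C * w) - 1 - t%:C * w) <= e / 2 * t.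
    by near=> t; split; near: t.
  have [n [nz nw]] := near_right_step ltr01 hzw.
  by exists n; rewrite -[_^-1]mul1r.
have n0 : 0 < n.+1%:R^-1 :> R by rewrite invr_gt0.
have powE (u : R[i]) : cexp u = cexp ((n.+1%:R^-1)%:C * u) ^+ n.+1.
  rewrite -cexpMn; congr cexp; rewrite -[RHS]mulr_natl mulrA.
  rewrite -(rmorph_nat (real_complex R)) -rmorphM /= mulfV ?pnatr_eq0//.
  by rewrite mul1r.
have le1 (u : R[i]) : complex.Re u <= 0 -> rnorm (cexp ((n.+1%:R^-1)%:C * u)) <= 1.
  move=> u0; rewrite rnorm_cexp complexReM /= mul0r subr0 -expR0 ler_expR.
  by rewrite pmulr_rle0.
have powB (a b : R[i]) k : rnorm a <= 1 -> rnorm b <= 1 ->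
    rnorm (a ^+ k - b ^+ k) <= k%:R * rnorm (a - b).
  move=> a1 b1; elim: k => [|k ih]; first by rewrite !expr0 subrr rnorm0 mul0r.
  have -> : a ^+ k.+1 - b ^+ k.+1 = a * (a ^+ k - b ^+ k) + (a - b) * b ^+ k.
    by rewrite !exprS; ring.
  have bk : rnorm (b ^+ k) <= 1.
    elim: k {ih} => [|k ih]; first by rewrite expr0 rnorm1.
    by rewrite exprS rnormM mulr_ile1// rnorm_ge0.
  apply: le_trans (ler_rnormD _ _) _; rewrite !rnormM -natr1 mulrDl mul1r.
  apply: lerD; last by rewrite ler_piMr ?rnorm_ge0.
  by apply: le_trans ih; rewrite ler_piMl ?rnorm_ge0.
rewrite (powE z) (powE w).
apply: le_trans (powB _ _ _ (le1 z z0) (le1 w w0)) _.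
set t := n.+1%:R^-1 in nz nw n0 powE le1 *.
have -> : cexp (t%:C * z) - cexp (t%:C * w) = (cexp (t%:C * z) - 1 - t%:C * z)
    - (cexp (t%:C * w) - 1 - t%:C * w) + t%:C * (z - w) by ring.
have -> : rnorm (z - w) + e = n.+1%:R * (t * rnorm (z - w) + e * t).
  by rewrite /t; field; rewrite addrC natr1 pnatr_eq0.
rewrite ler_pM2l ?ltr0n//.
apply: le_trans (ler_rnormD _ _) _; rewrite rnormM rnormC gtr0_norm// addrC lerD2l.
apply: le_trans (ler_rnormD _ _) _; rewrite rnormN.
by apply: le_trans (lerD nz nw) _; lra.
Unshelve. all: by end_near. Qed.

End ComplexExp.

(** * Projection-valued measures *)

Section ProjectionMeasure.
Context (R : realType) (H : hilbertType R) (E : pvm H).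
Implicit Types (X Y : set (Cborel R)) (f g h : H).

Lemma pvm_sub X Y f : measurable X -> measurable Y -> X `<=` Y ->
  E X (E Y f) = E X f.
Proof. by move=> mX mY XY; rewrite -pvmI// setIidl. Qed.

Lemma pvmK X f : measurable X -> E X (E X f) = E X f.
Proof. by move=> mX; apply: pvm_sub. Qed.

Lemma pvmC X Y f : measurable X -> measurable Y -> E X (E Y f) = E Y (E X f).
Proof. by move=> mX mY; rewrite -!pvmI// setIC. Qed.

Lemma pvm_disj X Y f : measurable X -> measurable Y -> X `&` Y = set0 ->
  E X (E Y f) = 0.
Proof. by move=> mX mY XY; rewrite -pvmI// XY pvm0. Qed.

Lemma hdot_pvm_dup X f g : measurable X ->
  hdot (E X f) g = hdot (E X f) (E X g).
Proof. by move=> mX; rewrite -pvm_selfadjoint// pvmK. Qed.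

Lemma rnorm_sqr_pvm X f : measurable X ->
  rnorm (E X f) ^+ 2 = complex.Re (hdot (E X f) f).
Proof. by move=> mX; rewrite hdot_pvm_dup// hdotxx. Qed.

Lemma rnorm_pvm_le X f : measurable X -> rnorm (E X f) <= rnorm f.
Proof.
move=> mX; have [->|Ef0] := eqVneq (rnorm (E X f)) 0; first exact: rnorm_ge0.
have p : 0 < rnorm (E X f) by rewrite lt_neqAle rnorm_ge0 eq_sym Ef0.
rewrite -(ler_pM2l p) -expr2 rnorm_sqr_pvm//.
by apply: le_trans (ler_norm _) (le_trans (ler_norm_Re _) (rnorm_hdot _ _)).
Qed.

Lemma rnorm_hdot_pvm X f g : measurable X ->
  rnorm (hdot (E X f) g) <= rnorm f * rnorm g.
Proof.
move=> mX; apply: le_trans (rnorm_hdot _ _) _.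
by rewrite ler_wpM2r ?rnorm_ge0// rnorm_pvm_le.
Qed.

Lemma pvm_cvg_sum (F : (set (Cborel R))^nat) f :
  (forall n, measurable (F n)) -> trivIset setT F ->
  (fun n => \sum_(i < n) E (F i) f) @ \oo --> E (\bigcup_n F n) f.
Proof.
move=> mF tF; have := @pvm_sigma_additive _ _ E F mF tF f.
by rewrite /series; under eq_fun do rewrite /= big_mkord.
Qed.

(** Finite additivity: the sequence is completed with empty sets, and the partial
    sums of the countable series become constant. *)
Lemma pvm_sum n (F : nat -> set (Cborel R)) (D : set (Cborel R)) f :
  mpartition D n F -> E D f = \sum_(i < n) E (F i) f.
Proof.
move=> [mF tF FD].
pose G i := if (i < n)%N then F i else set0.
have mG i : measurable (G i) by rewrite /G; case: ifP.
have tG : trivIset setT G.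
  move=> i j _ _ [x []]; rewrite /G; case: ifPn => // iN; case: ifPn => // jN Fi Fj.
  by apply: tF => //; exists x.
have GD : \bigcup_i G i = D.
  rewrite -FD; apply/seteqP; split => x [k].
    by move=> _; rewrite /G; case: ifPn => // kn Fk; exists k.
  by move=> /= kn Fk; exists k => //; rewrite /G kn.
have := @pvm_cvg_sum _ f mG tG; rewrite GD => /cvg_rnorm_seqP cv.
apply/eqP; rewrite -subr_eq0 -rnorm_eq0 eq_le rnorm_ge0 andbT.
apply: (@le_mulgt0 _ _ 1) => e e0; have [N hN] := cv e e0.
rewrite mul1r; have := ltW (hN (n + N)%N (leq_addl _ _)); congr (rnorm (_ - _) <= _).
rewrite big_split_ord /= [X in _ + X]big1 ?addr0.
  by apply: eq_bigr => i _; rewrite /G ltn_ord.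
by move=> i _; rewrite /G ltnNge leq_addr /= pvm0.
Qed.

Lemma pvm_setU X Y f : measurable X -> measurable Y -> X `&` Y = set0 ->
  E (X `|` Y) f = E X f + E Y f.
Proof.
move=> mX mY XY; pose F (i : nat) := if i is 0%N then X else Y.
have pF : mpartition (X `|` Y) 2 F.
  split.
  - by case.
  - have no x : X x -> Y x -> False.
      by move=> Xx Yx; have : (X `&` Y) x by []; rewrite XY.
    by move=> [|[|i]] [|[|j]] //= _ _ [x [h1 h2]]; exfalso; exact: (no x).
  - by rewrite bigcup_mkord big_ord_recr /= big_ord1.
by rewrite (pvm_sum _ pF) big_ord_recr /= big_ord1.
Qed.

Lemma pvm_compl X f : measurable X -> E (~` X) f = f - E X f.
Proof.
move=> mX; have := pvm_setU f mX (measurableC mX) (setICr X).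
by rewrite setUv pvmT => {2}->; rewrite addrC addKr.
Qed.

Lemma pvm_cvg_nondecreasing (F : (set (Cborel R))^nat) f :
  (forall n, measurable (F n)) -> (forall n m, (n <= m)%N -> F n `<=` F m) ->
  (fun n => E (F n) f) @ \oo --> E (\bigcup_n F n) f.
Proof.
move=> mF ndF; pose G := seqDU F.
have mG n : measurable (G n).
  by apply: measurableD => //; exact: bigsetU_measurable.
have tG : trivIset setT G := @trivIset_seqDU _ F.
have pF n : mpartition (F n) n.+1 G.
  split=> //; first by move=> i j _ _; exact: tG.
  rewrite bigcup_mkord -bigsetU_seqDU -bigcup_mkord.
  apply/seteqP; split => [x [k /=]|x Fx]; last by exists n => //=.
  by rewrite ltnS => kn; exact: ndF.
have -> : (fun n => E (F n) f) = (fun n => \sum_(i < n.+1) E (G i) f).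
  by apply/funext => n; exact: pvm_sum.
rewrite seqDU_bigcup_eq.
have /cvg_rnorm_seqP cv := @pvm_cvg_sum _ f mG tG.
apply/cvg_rnorm_seqP => e /cv[N hN]; exists N => n Nn.
by apply: hN; exact: leqW.
Qed.

Definition pvm_null X : Prop := forall f, E X f = 0.

Lemma pvm_null_sub X Y : measurable X -> measurable Y -> X `<=` Y ->
  pvm_null Y -> pvm_null X.
Proof. by move=> mX mY XY nY f; rewrite -(pvm_sub _ mX mY XY) nY linear0. Qed.

(** Disjoint pieces are needed for additivity, hence the passage to [seqDU]. *)
Lemma pvm_null_bigcup (F : nat -> set (Cborel R)) :
  (forall n, measurable (F n)) -> (forall n, pvm_null (F n)) ->
  pvm_null (\bigcup_n F n).
Proof.
move=> mF nF f.
rewrite seqDU_bigcup_eq; set G := seqDU F.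
have mG n : measurable (G n).
  by apply: measurableD => //; exact: bigsetU_measurable.
have nG n g : E (G n) g = 0.
  by rewrite -(pvm_sub _ (mG n) (mF n) (@subset_seqDU _ F n)) nF linear0.
have /cvg_rnorm_seqP cv := @pvm_cvg_sum _ f mG (@trivIset_seqDU _ F).
apply/eqP; rewrite -rnorm_eq0 eq_le rnorm_ge0 andbT.
apply: (@le_mulgt0 _ _ 1) => e e0; have [N hN] := cv e e0.
by rewrite mul1r; have := ltW (hN N (leqnn N)); rewrite big1 ?subr0.
Qed.

(** Each point of [U] lies in a disk with rational centre and rational radius
    inside its null disk, and there are countably many of these. *)
Lemma pvm_null_local (U : set (Cborel R)) : measurable U ->
  (forall z, U z -> exists2 r : R, 0 < r & pvm_null (disk z r)) ->
  pvm_null U.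
Proof.
move=> mU Uloc.
pose B (t : rat * rat * nat) : set (Cborel R) :=
  disk (ratr t.1.1 +i* ratr t.1.2) t.2.+1%:R^-1.
pose F n : set (Cborel R) := if @unpickle (rat * rat * nat)%type n is Some t
  then if `[< pvm_null (B t) >] then B t else set0 else set0.
have mF n : measurable (F n).
  rewrite /F; case: unpickle => [t|//]; case: ifP => // _.
  exact: disk_measurable.
have nF n : pvm_null (F n).
  rewrite /F; case: unpickle => [t|]; last by move=> f; rewrite pvm0.
  by case: ifPn => [/asboolP//|_ f]; rewrite pvm0.
have mB : measurable (\bigcup_n F n) by exact: bigcupT_measurable.
apply: (@pvm_null_sub _ _ mU mB); last exact: pvm_null_bigcup.
move=> z /Uloc[r r0 nr].
have /cvgrPdist_lt/(_ _ (divr_gt0 r0 (ltr0n R 2)))[k _ hk] := @cvg_harmonic R.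
have {hk} kr : k.+1%:R^-1 < r / 2.
  by have := hk k (leqnn k); rewrite /= sub0r normrN ger0_norm.
have k0 : 0 < k.+1%:R^-1 :> R by rewrite invr_gt0.
set d := k.+1%:R^-1 in kr k0.
have ratapprox (x : R) : exists q : rat, `|x - ratr q| < d / 2.
  have [q] : exists q : rat, ratr q \in `]x - d / 2, x + d / 2[.
    apply: rat_in_itvoo; lra.
  rewrite in_itv /= => /andP[h1 h2]; exists q.
  by rewrite ltr_norml; apply/andP; split; lra.
have [p hp] := ratapprox (complex.Re z); have [q hq] := ratapprox (complex.Im z).
have zc : rnorm (z - (ratr p +i* ratr q)) < d.
  apply: le_lt_trans (rnorm_leD _) _.
  by rewrite complexReD complexImD complexReN complexImN /=; lra.
have [n hn] : exists n, unpickle n = Some (p, q, k).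
  by exists (pickle (p, q, k)); exact: pickleK.
exists n => //; rewrite /F hn ifT; first exact: zc.
apply/asboolP; apply: pvm_null_sub nr; [exact: disk_measurable|
  exact: disk_measurable|].
move=> w; rewrite /B /disk /= => wc.
have -> : w - z = (w - (ratr p +i* ratr q)) - (z - (ratr p +i* ratr q)).
  by rewrite opprB addrA subrK.
apply: le_lt_trans (ler_rnormD _ _) _; rewrite rnormN.
by move: wc zc kr; rewrite -/d; lra.
Qed.

End ProjectionMeasure.

(** * Resolvents and null sets of the spectral measure *)

Section ResolventOpen.
Context (R : realType) (H : hilbertType R).

(** Neumann series: the iterates of [y |-> f - K y] converge geometrically, and
    [|y + K y| >= (1 - q) |y|] gives uniqueness and the bound on the inverse. *)
Lemma neumann_inverse (K : bounded_op H H) (q : R) : 0 <= q -> q < 1 ->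
  (forall x, rnorm (K x) <= q * rnorm x) ->
  exists C : bounded_op H H, forall f y, y + K y = f <-> y = C f.
Proof.
move=> q0 q1 Kq.
have q1' : 0 < 1 - q by rewrite subr_gt0.
have lb y : (1 - q) * rnorm y <= rnorm (y + K y).
  have := ler_rnormD (y + K y) (- K y); rewrite addrK rnormN.
  by have := Kq y; lra.
have inj y y' : y + K y = y' + K y' -> y = y'.
  move=> e; apply/eqP; rewrite -subr_eq0 -rnorm_eq0 eq_le rnorm_ge0 andbT.
  rewrite -(ler_pM2l q1') mulr0; apply: le_trans (lb _) _.
  by rewrite linearB addrACA -opprD e subrr rnorm0.
have sol f : exists y, y + K y = f.
  pose u n := iter n (fun y => f - K y) 0.
  have uS n : u n.+1 = f - K (u n) by [].
  have [|y uy] := @cauchy_step_cvg _ _ u (rnorm f) q q0 q1.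
    elim=> [|n ih]; first by rewrite uS /u /= linear0 !subr0 expr0 mulr1.
    rewrite uS [u n.+1]uS subr_cancel -linearB.
    apply: le_trans (Kq _) _; rewrite exprS mulrCA ler_wpM2l//.
    by rewrite rnormBC.
  move/cvg_rnorm_seqP in uy; exists y; apply/eqP.
  rewrite -subr_eq0 -rnorm_eq0 eq_le rnorm_ge0 andbT.
  apply: (@le_mulgt0 _ _ 2) => e e0; have [N hN] := uy e e0.
  have -> : y + K y - f = (y - u N.+1) + K (y - u N).
    rewrite uS (linearB K); move: (K y) (K (u N)) => k l.
    by rewrite opprB addrACA [l - f - l]addrAC subrr sub0r.
  apply: le_trans (ler_rnormD _ _) _.
  have h1 := hN N.+1 (leqnSn N); have h2 := hN N (leqnn N).
  have := Kq (y - u N); have := rnorm_ge0 (y - u N); nra.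
have [C CP] := choice sol.
have Cuniq f y : y + K y = f <-> y = C f.
  by split => [yf|->//]; apply: inj; rewrite yf CP.
have Clin : linear C.
  move=> a f g; apply/esym/Cuniq.
  by rewrite linearP addrACA -scalerDr !CP.
pose CL : {linear H -> H} := HB.pack C (GRing.isLinear.Build _ _ _ _ C Clin).
have Cb : exists M : R, forall x, rnorm (CL x) <= M * rnorm x.
  exists (1 - q)^-1 => x; rewrite mulrC ler_pdivlMr// mulrC.
  by apply: le_trans (lb _) _; rewrite CP.
by exists (BoundedOp Cb).
Qed.

(** Since [z - A = (1 + (z - z0) B) (z0 - A)], where [B] inverts [z0 - A], it is
    enough that [(z - z0) B] has norm less than one. *)
Lemma resolvent_set_open (A : unbounded_op H H) (z0 : R[i]) :
  resolvent_set A z0 ->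
  exists2 r : R, 0 < r & forall z, rnorm (z0 - z) < r -> resolvent_set A z.
Proof.
move=> [B [B1 B2]]; have [M M0 BM] := bop_boundedW B.
exists M^-1; first by rewrite invr_gt0.
move=> z zr; pose q := rnorm (z - z0) * M.
have q1 : q < 1 by rewrite /q rnormBC -ltr_pdivlMr// mul1r.
have q0 : 0 <= q by rewrite mulr_ge0 ?rnorm_ge0// ltW.
pose Kf (f : H) : H := (z - z0) *: B f.
have Klin : linear Kf.
  by move=> a f g; rewrite /Kf linearP scalerDr !scalerA mulrC.
pose KL : {linear H -> H} := HB.pack Kf (GRing.isLinear.Build _ _ _ _ Kf Klin).
have Kq x : rnorm (KL x) <= q * rnorm x.
  by rewrite /= rnormZ /q -mulrA ler_wpM2l ?rnorm_ge0.
have Kb : exists M : R, forall x, rnorm (KL x) <= M * rnorm x by exists q.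
pose K := BoundedOp Kb.
have [C CP] := neumann_inverse (K := K) q0 q1 Kq.
pose BCf (f : H) : H := B (C f).
have BClin : linear BCf by move=> a f g; rewrite /BCf !linearP.
pose BC : {linear H -> H} := HB.pack BCf (GRing.isLinear.Build _ _ _ _ BCf BClin).
have BCb : exists M : R, forall x, rnorm (BC x) <= M * rnorm x.
  have [M' M'0 CM] := bop_boundedW C; exists (M * M') => x.
  by apply: le_trans (BM _) _; rewrite -mulrA ler_pM2l.
exists (BoundedOp BCb); split => [f|f Af] /=.
  have [dB eB] := B1 (C f); split => //.
  have e : C f + Kf (C f) = f := (CP f (C f)).2 erefl.
  rewrite -[RHS]e -[X in _ = X + _]eB /Kf /BCf scalerBl.
  by rewrite [RHS]addrC addrA subrK.
have Ce : z0 *: f - A f = C (z *: f - A f).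
  by apply/CP; rewrite /= /Kf B2// scalerBl addrC addrA subrK.
by rewrite /BCf -Ce; exact: B2.
Qed.

Lemma spectrum_measurable (A : unbounded_op H H) :
  measurable (spectrum A : set (Cborel R)).
Proof.
apply: measurableC; apply: Cborel_open; apply: open_rnormP => z /resolvent_set_open.
by move=> [r r0 h]; exists r.
Qed.

End ResolventOpen.

Section Spectral.
Context (R : realType) (H : hilbertType R) (A : unbounded_op H H) (E : pvm H).
Hypothesis spectralE : spectral_measure A E.
Implicit Types (f g v w : H) (D X : set (Cborel R)).

Lemma rnorm_pvm_measure v w X : measurable X ->
  rnorm (pvm_measure E v w X) <= rnorm v * rnorm w.
Proof. exact: rnorm_hdot_pvm. Qed.

(** The function [|z|^2] is bounded where the measure [<E v, v>] lives. *)
Lemma pvm_dom D (M : R) v : measurable D ->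
  (forall z, D z -> rnorm (z : R[i]) <= M) -> E D v = v -> dom A v.
Proof.
move=> mD DM Dv; have [-> _] := spectralE; rewrite /=.
have tvN : tv (pvm_measure E v v) (~` D) = 0%E.
  apply: tv_null => X mX XD; rewrite /= -Dv pvm_disj ?linear0l//.
  by apply/disjoints_subset.
have msq : measurable_fun setT (fun z : Cborel R => ((rnorm (z : R[i])) ^+ 2)%:E).
  by apply/measurable_EFinP; apply: measurable_funX; exact: rnorm_measurable.
rewrite (ge0_negligible_integral (measurableC mD))//; last first.
  by move=> z _; rewrite lee_fin sqr_ge0.
rewrite setTD setCK.
apply: (@le_lt_trans _ _ (\int[tv (pvm_measure E v v)]_(z in D) (cst (M ^+ 2)%:E z))%E).
  apply: ge0_le_integral => //.
  - by move=> z _ /=; rewrite lee_fin sqr_ge0.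
  - exact: (measurable_funS measurableT _ msq).
  - move=> z /DM zM; rewrite lee_fin ler_pXn2r ?nnegrE ?rnorm_ge0//.
    exact: le_trans (rnorm_ge0 _) zM.
rewrite integral_cst//; apply: lte_mul_pinfty => //.
  by rewrite lee_fin sqr_ge0.
rewrite -ge0_fin_numE ?tv_ge0//.
exact: (tv_fin_num (@rnorm_pvm_measure v v)).
Qed.

(** On a small piece of the spectrum around [z0] the operator is nearly
    multiplication by [z0]. *)
Lemma pvm_near v w (z0 : R[i]) (e B : R) D : measurable D -> 0 <= e ->
  (forall z : R[i], D z -> rnorm (z - z0) <= e) -> dom A v ->
  (forall X, measurable X -> X `<=` ~` D -> hdot (E X v) w = 0) ->
  (forall X, measurable X -> rnorm (hdot (E X v) w) <= B) ->
  rnorm (hdot (A v) w - z0 * hdot v w) <= 8 * B * e.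
Proof.
move=> mD e0 De Av null bound; have [_ AE] := spectralE.
have vw : hdot v w = hdot (E D v) w.
  have := null _ (measurableC mD) (@subset_refl _ _).
  by rewrite pvm_compl// linearBl /= => /eqP; rewrite subr_eq0 => /eqP.
rewrite AE// vw.
apply: (cintegral_near_cst (nu := pvm_measure E v w) bound mD) => //.
  exact: Re_measurable.
exact: Im_measurable.
Qed.

(** The bound involves [E D w] rather than [w], which lets the errors of many
    orthogonal pieces be summed without loss. *)
Lemma pvm_near_range (v w : H) (z0 : R[i]) (e : R) D : measurable D -> 0 <= e ->
  (forall z : R[i], D z -> rnorm (z - z0) <= e) ->
  rnorm (hdot (A (E D v)) w - z0 * hdot (E D v) w)
    <= 8 * (rnorm (E D v) * rnorm (E D w)) * e.
Proof.
move=> mD e0 De; apply: (pvm_near mD e0 De).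
- apply: (@pvm_dom D (rnorm z0 + e)) => //; last exact: pvmK.
  move=> z Dz; rewrite -[z : R[i]](subrK z0); apply: le_trans (ler_rnormD _ _) _.
  by rewrite addrC lerD2l De.
- move=> X mX XD; rewrite pvm_disj ?linear0l//.
  exact/disjoints_subset.
- move=> X mX; have -> : hdot (E X (E D v)) w = hdot (E X (E D v)) (E D w).
    by rewrite -pvm_selfadjoint// pvmC// pvmK.
  exact: rnorm_hdot_pvm.
Qed.

(** Testing [A k] against [E D k] localizes the measure to [D]; for [k] in the
    kernel of [A] this forces [E D k = 0] when [D] stays away from [0]. *)
Lemma pvm_near_diag (k : H) (z0 : R[i]) (e : R) D : measurable D -> 0 <= e ->
  (forall z : R[i], D z -> rnorm (z - z0) <= e) -> dom A k ->
  rnorm (hdot (A k) (E D k) - z0 * (rnorm (E D k) ^+ 2)%:C)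
    <= 8 * rnorm (E D k) ^+ 2 * e.
Proof.
move=> mD e0 De Ak; rewrite -hdotxx -[hdot (E D k) _]hdot_pvm_dup// pvm_selfadjoint//.
apply: (pvm_near mD e0 De Ak).
- move=> X mX XD; rewrite -pvm_selfadjoint// pvm_disj ?linear0l//.
  by rewrite setIC; apply/disjoints_subset.
- move=> X mX; have -> : hdot (E X k) (E D k) = hdot (E X (E D k)) (E D k).
    by rewrite [in RHS]pvmC// -hdot_pvm_dup// -pvm_selfadjoint.
  by rewrite expr2; exact: rnorm_hdot_pvm.
Qed.

(** If [v] is in the range of [E] of a small disk, [z0 v - A v] is small compared
    with [v], while the resolvent recovers [v] from it. *)
Lemma resolvent_null (z0 : R[i]) : resolvent_set A z0 ->
  exists2 r : R, 0 < r & pvm_null E (disk z0 r).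
Proof.
move=> [B [_ BP]]; have [M M0 BM] := bop_boundedW B.
(* With this radius the resolvent bound reads [|v| <= M * 8 r |v| = |v| / 2]. *)
have r0 : 0 < (16 * M)^-1 by rewrite invr_gt0 mulr_gt0.
set r := _^-1 in r0; exists r => // f.
have mD := disk_measurable z0 r; set D := disk z0 r in mD *.
have De (z : R[i]) : D z -> rnorm (z - z0) <= r by move=> /ltW.
have Ddom : dom A (E D f).
  apply: (@pvm_dom D (rnorm z0 + r)) => //; last exact: pvmK.
  move=> z Dz; rewrite -[z : R[i]](subrK z0); apply: le_trans (ler_rnormD _ _) _.
  by rewrite addrC lerD2l De.
set v := E D f in Ddom *; pose u := z0 *: v - A v.
have u_le : rnorm u <= 8 * rnorm v * r.
  apply: rnorm_le_hdot; first by rewrite !mulr_ge0 ?rnorm_ge0// ltW.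
  move=> w; rewrite /u linearBl /= hdotZl rnormBC.
  apply: le_trans (pvm_near_range f w mD (ltW r0) De) _; rewrite -/v.
  have c0 : 0 <= 8 * rnorm v * r by rewrite !mulr_ge0 ?rnorm_ge0// ltW.
  by have := ler_wpM2l c0 (rnorm_pvm_le E w mD); lra.
apply/eqP; rewrite -rnorm_eq0 eq_le rnorm_ge0 andbT.
have := BM u; rewrite BP//.
have : M * rnorm u <= M * (8 * rnorm v * r) by rewrite ler_pM2l.
have -> : M * (8 * rnorm v * r) = rnorm v / 2.
  by rewrite /r; field; apply: lt0r_neq0.
by have := rnorm_ge0 v; lra.
Qed.

Lemma spectrum_full f : E (~` (spectrum A : set (Cborel R))) f = 0.
Proof.
apply: pvm_null_local; first by apply: measurableC; exact: spectrum_measurable.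
by move=> z /contrapT; exact: resolvent_null.
Qed.

(** A vector [u] in the range of [E] of a small disk around [z0] is orthogonal to
    the kernel of [A], because the disk avoids [0], and [Re <A u, u>] is close to
    [Re z0 * |u|^2 < gamma1 * |u|^2]; the variational form of the gap excludes
    [u <> 0]. *)
Lemma gap_null_disk (gamma1 : R) (z0 : R[i]) : spectral_gap A gamma1 ->
  complex.Re z0 < gamma1 -> z0 != 0 ->
  exists2 r : R, 0 < r & pvm_null E (disk z0 r).
Proof.
move=> [_ _ gapE g0] z0g z00.
have z0p : 0 < rnorm z0 by rewrite lt_neqAle rnorm_ge0 eq_sym rnorm_eq0 z00.
pose m := Num.min (rnorm z0) (gamma1 - complex.Re z0).
have m0 : 0 < m by rewrite lt_min z0p subr_gt0.
have r0 : 0 < m / 16 by rewrite divr_gt0.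
set r := m / 16 in r0; exists r => // f.
have mD := disk_measurable z0 r; set D := disk z0 r in mD *.
have De (z : R[i]) : D z -> rnorm (z - z0) <= r by move=> /ltW.
have Ddom : dom A (E D f).
  apply: (@pvm_dom D (rnorm z0 + r)) => //; last exact: pvmK.
  move=> z Dz; rewrite -[z : R[i]](subrK z0); apply: le_trans (ler_rnormD _ _) _.
  by rewrite addrC lerD2l De.
have rz : 8 * r < rnorm z0.
  have : m <= rnorm z0 by rewrite ge_min lexx.
  by rewrite /r; lra.
have rg : 8 * r < gamma1 - complex.Re z0.
  have : m <= gamma1 - complex.Re z0 by rewrite ge_min lexx orbT.
  by rewrite /r; lra.
set u := E D f.
have uker : orthocompl (op_ker A) u.
  move=> k [Ak Ak0]; rewrite pvm_selfadjoint//.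
  suff -> : E D k = 0 by rewrite linear0r.
  apply/eqP; rewrite -rnorm_eq0 -sqrf_eq0 eq_le sqr_ge0 andbT.
  have := pvm_near_diag mD (ltW r0) De Ak.
  rewrite Ak0 linear0l sub0r rnormN rnormM rnormC ger0_norm ?sqr_ge0// => h.
  have p : 0 < rnorm z0 - 8 * r by rewrite subr_gt0.
  by rewrite -(ler_pM2l p) mulr0; lra.
apply/eqP/negPn/negP => u0.
have up : 0 < rnorm u by rewrite lt_neqAle rnorm_ge0 eq_sym rnorm_eq0 u0.
have : (gamma1%:E <= (complex.Re (hdot (A u) u) / rnorm u ^+ 2)%:E)%E.
  by rewrite gapE; apply: ereal_inf_lbound; exists u => //; split.
rewrite lee_fin ler_pdivlMr ?exprn_gt0// => h1.
have := pvm_near_diag mD (ltW r0) De Ddom; rewrite -/u pvmK// -/u => h2.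
have := le_trans (le_trans (ler_norm _) (ler_norm_Re _)) h2.
rewrite complexReD complexReN complexReM /= mulr0 subr0.
have q0 : 0 < rnorm u ^+ 2 by rewrite exprn_gt0.
have rg' : 0 < gamma1 - complex.Re z0 - 8 * r by rewrite subr_gt0.
by have := mulr_gt0 rg' q0; lra.
Qed.

Lemma gap_null f (gamma1 : R) : spectral_gap A gamma1 ->
  E ([set z | complex.Re z < gamma1] `\ 0) f = 0.
Proof.
move=> gap; apply: pvm_null_local.
  by apply: measurableD; [exact: halfplane_measurable|exact: set1_measurable].
by move=> z [/= zg /eqP z0]; exact: gap_null_disk gap zg z0.
Qed.

End Spectral.

(** * Discretized spectral integrals of a semigroup *)

Section Kernel.
Context (R : realType).

Lemma cexp_kernel_bmeasurable (D : set (Cborel R)) (t : R) : 0 <= t ->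
  measurable D -> (forall z : R[i], D z -> 0 <= complex.Re z) ->
  bmeasurable D (fun z : R[i] => cexp (- (z * t%:C))).
Proof.
move=> t0 mD D0.
have mRe : measurable_fun D (fun z : Cborel R => - (complex.Re (z : R[i]) * t)).
  apply/measurable_funN/measurable_funM => //.
  exact: (measurable_funS measurableT _ (@Re_measurable R)).
have mIm : measurable_fun D (fun z : Cborel R => - (complex.Im (z : R[i]) * t)).
  apply/measurable_funN/measurable_funM => //.
  exact: (measurable_funS measurableT _ (@Im_measurable R)).
have ReE (z : R[i]) : complex.Re (- (z * t%:C)) = - (complex.Re z * t).
  by rewrite complexReN complexReM /= mulr0 subr0.
have ImE (z : R[i]) : complex.Im (- (z * t%:C)) = - (complex.Im z * t).
  by rewrite complexImN complexImM /= mulr0 add0r.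
have mexp : measurable_fun D (fun z : Cborel R => expR (- (complex.Re (z : R[i]) * t))).
  exact: measurableT_comp (@measurable_expR R) mRe.
split.
- rewrite /cexp /=; under eq_fun do rewrite ReE ImE.
  apply: measurable_funM => //; apply: measurableT_comp mIm.
  by apply: continuous_measurable_fun; exact: continuous_cos.
- rewrite /cexp /=; under eq_fun do rewrite ReE ImE.
  apply: measurable_funM => //; apply: measurableT_comp mIm.
  by apply: continuous_measurable_fun; exact: continuous_sin.
- exists 1 => z /D0 z0; rewrite rnorm_cexp ReE -expR0 ler_expR oppr_le0.
  exact: mulr_ge0.
Qed.

(** Multiplied by [x y], each term is at most half of
    [(y a_i)^2 + (x b_i)^2]; the bounds on single terms settle [x = 0] and
    [y = 0]. *)
Lemma sum_cauchy_schwarz n (a b : 'I_n -> R) (x y : R) :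
  0 <= x -> 0 <= y -> (forall i, 0 <= a i <= x) -> (forall i, 0 <= b i <= y) ->
  \sum_i a i ^+ 2 <= x ^+ 2 -> \sum_i b i ^+ 2 <= y ^+ 2 ->
  \sum_i a i * b i <= x * y.
Proof.
move=> x0 y0 ax byy sa sb.
have [xz|xz] := eqVneq x 0.
  rewrite xz mul0r big1// => i _.
  by have := ax i; rewrite xz => /le_anti <-; rewrite mul0r.
have [yz|yz] := eqVneq y 0.
  rewrite yz mulr0 big1// => i _.
  by have := byy i; rewrite yz => /le_anti <-; rewrite mulr0.
have xp : 0 < x by rewrite lt_neqAle eq_sym xz.
have yp : 0 < y by rewrite lt_neqAle eq_sym yz.
rewrite -(ler_pM2l (mulr_gt0 xp yp)).
apply: (@le_trans _ _ ((y ^+ 2 * \sum_i a i ^+ 2 + x ^+ 2 * \sum_i b i ^+ 2) / 2)).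
  rewrite !mulr_sumr -big_split /= mulr_suml; apply: ler_sum => i _.
  have := sqr_ge0 (y * a i - x * b i); lra.
have := ler_wpM2l (sqr_ge0 y) sa; have := ler_wpM2l (sqr_ge0 x) sb; lra.
Qed.

End Kernel.

Section SemigroupCalculus.
Context (R : realType) (H : hilbertType R) (A : unbounded_op H H) (E : pvm H).
Context (P : R -> bounded_op H H).
Hypothesis spectralE : spectral_measure A E.
Hypothesis semigroupP : contraction_semigroup P.
Hypothesis generatorP : is_generator P (op_opp A).
Implicit Types (v w h : H) (D X : set (Cborel R)) (t : R).

Lemma semigroup_le t v : 0 <= t -> rnorm (P t v) <= rnorm v.
Proof. by case: semigroupP => _ _ _ h /h. Qed.

Lemma generator_first_order v (e : R) : dom A v -> 0 < e ->
  \forall t \near (0 : R)^'+, rnorm (P t v - v + t%:C *: A v) <= e * t.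
Proof.
move=> Av e0; have [/(_ (conj Av erefl)) + _] := generatorP v (- A v).
move=> /cvg_rnormP/(_ _ e0) cv.
near=> t.
have t0 : 0 < t by near: t; exact: nbhs_right_gt.
have : rnorm (- A v - (t^-1)%:C *: (P t v - v)) < e by near: t.
have -> : P t v - v + t%:C *: A v =
    - (t%:C *: (- A v - (t^-1)%:C *: (P t v - v))).
  rewrite scalerBr scalerN scalerA -rmorphM /= mulfV ?lt0r_neq0//.
  by rewrite scale1r opprB opprK.
by rewrite rnormN rnormZ rnormC gtr0_norm// mulrC => /ltW; rewrite ler_pM2r.
Unshelve. all: by end_near. Qed.

Lemma eigen_first_order v (z : R[i]) (e : R) : dom A v -> 0 < e ->
  \forall t \near (0 : R)^'+,
    rnorm (P t v - cexp (- (z * t%:C)) *: v + t%:C *: (A v - z *: v)) <= e * t.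
Proof.
move=> Av e0; have e2 : 0 < e / 2 by rewrite divr_gt0.
have v1 : 0 < rnorm v + 1 by rewrite ltr_wpDl ?rnorm_ge0.
have hg := generator_first_order Av e2.
have hx := cexp_first_order (- z) (divr_gt0 e2 v1).
near=> t.
have t0 : 0 < t by near: t; exact: nbhs_right_gt.
have h1 : rnorm (P t v - v + t%:C *: A v) <= e / 2 * t by near: t.
have h2 : rnorm (cexp (t%:C * - z) - 1 - t%:C * - z) <= e / 2 / (rnorm v + 1) * t.
  by near: t.
have -> : P t v - cexp (- (z * t%:C)) *: v + t%:C *: (A v - z *: v) =
    (P t v - v + t%:C *: A v) - (cexp (t%:C * - z) - 1 - t%:C * - z) *: v.
  have zmodE (a b d x y : H) : a - b + (d - x) = (a - y + d) - (b - y + x).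
    by rewrite opprD opprB [RHS]addrACA; congr (_ + _); rewrite addrA subrK.
  rewrite mulrN [t%:C * z]mulrC !scalerBl scale1r scaleNr opprK scalerBr scalerA.
  by rewrite [t%:C * z]mulrC; exact: zmodE.
apply: le_trans (ler_rnormD _ _) _; rewrite rnormN rnormZ.
have : rnorm (cexp (t%:C * - z) - 1 - t%:C * - z) * rnorm v <= e / 2 * t.
  have := ler_wpM2r (rnorm_ge0 v) h2; move=> /le_trans; apply.
  rewrite mulrAC ler_wpM2r ?(ltW t0)// -[leLHS]mulrA ler_piMr ?(ltW e2)//.
  by rewrite ler_pdivrMl// mulr1 lerDl.
by lra.
Unshelve. all: by end_near. Qed.

(** Riemann sum for the integral of [exp (- z t)] against [E]. *)
Definition spectral_sum n (F : nat -> set (Cborel R)) (c : nat -> R[i]) h t : H :=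
  \sum_(i < n) cexp (- (c i * t%:C)) *: E (F i) h.

Section Approximation.
Variables (n : nat) (F : nat -> set (Cborel R)) (c : nat -> R[i]).
Variables (D : set (Cborel R)) (e : R) (h : H).
Hypothesis pD : mpartition D n F.
Hypothesis e0 : 0 <= e.
Hypothesis Fe : forall i, (i < n)%N -> forall z : R[i], F i z -> rnorm (z - c i) <= e.
Hypothesis c0 : forall i, (i < n)%N -> 0 <= complex.Re (c i).

Let mF i : measurable (F i). Proof. by case: pD. Qed.

Lemma sum_sqr_pvm_le w : \sum_(i < n) rnorm (E (F i) w) ^+ 2 <= rnorm w ^+ 2.
Proof.
have -> : \sum_(i < n) rnorm (E (F i) w) ^+ 2 = rnorm (E D w) ^+ 2.
  rewrite rnorm_sqr_pvm; last exact: (mpartition_measurable pD).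
  rewrite (pvm_sum _ _ pD) hdot_suml.
  elim/big_ind2 : _ => [//|x1 x2 y1 y2 -> ->|i _]; first by rewrite complexReD.
  exact: rnorm_sqr_pvm.
rewrite ler_pXn2r ?nnegrE ?rnorm_ge0//; apply: rnorm_pvm_le.
exact: (mpartition_measurable pD).
Qed.

Lemma piece_dom i : (i < n)%N -> dom A (E (F i) h).
Proof.
move=> iN; apply: (pvm_dom spectralE (mF i) (M := rnorm (c i) + e)); last exact: pvmK.
move=> z Fz; rewrite -[z : R[i]](subrK (c i)); apply: le_trans (ler_rnormD _ _) _.
by rewrite addrC lerD2l (Fe iN).
Qed.

Lemma rnorm_cexp_le1 i t : (i < n)%N -> 0 <= t -> rnorm (cexp (- (c i * t%:C))) <= 1.
Proof.
move=> iN t0; rewrite rnorm_cexp complexReN complexReM /= mulr0 subr0 -expR0.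
by rewrite ler_expR oppr_le0 mulr_ge0// c0.
Qed.

(** What the evolution equation misses on a spectral sum. The pieces
    [A (E (F i) h) - c i E (F i) h] are small relative to [E (F i) h] and are
    tested against orthogonal pieces of [w], so the bound does not grow with the
    number of cells. *)
Lemma residual_le t : 0 <= t ->
  rnorm (\sum_(i < n) cexp (- (c i * t%:C)) *: (A (E (F i) h) - c i *: E (F i) h))
    <= 8 * e * rnorm h.
Proof.
move=> t0; apply: rnorm_le_hdot; first by rewrite !mulr_ge0 ?rnorm_ge0.
move=> w; rewrite hdot_suml; apply: le_trans (ler_rnorm_sum _ _) _.
apply: (@le_trans _ _ (\sum_(i < n) 8 * e * (rnorm (E (F i) h) * rnorm (E (F i) w)))).
  apply: ler_sum => i _; rewrite hdotZl rnormM linearBl /= hdotZl.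
  have hn := pvm_near_range spectralE h w (mF i) e0 (Fe (ltn_ord i)).
  have := rnorm_cexp_le1 (ltn_ord i) t0.
  have := rnorm_ge0 (cexp (- (c i * t%:C))).
  have := rnorm_ge0 (hdot (A (E (F i) h)) w - c i * hdot (E (F i) h) w); nra.
rewrite -mulr_sumr -[leRHS]mulrA ler_wpM2l ?mulr_ge0//.
by apply: sum_cauchy_schwarz; rewrite ?rnorm_ge0 ?sum_sqr_pvm_le// => i;
  rewrite rnorm_ge0 rnorm_pvm_le.
Qed.

(** The expansion at [d = 0] of [P d] on each of the finitely many pieces does not
    involve [s], which makes the error [eta] uniform in [s]. *)
Lemma spectral_sum_step (eta : R) : 0 < eta ->
  \forall d \near (0 : R)^'+, forall s, 0 <= s ->
    rnorm (P d (spectral_sum n F c h s) - spectral_sum n F c h (s + d))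
      <= d * (8 * e * rnorm h + eta).
Proof.
move=> eta0; pose eta' := eta / n.+1%:R.
have eta'0 : 0 < eta' by rewrite divr_gt0.
have hi : \forall d \near (0 : R)^'+, forall i : 'I_n,
    rnorm (P d (E (F i) h) - cexp (- (c i * d%:C)) *: E (F i) h
      + d%:C *: (A (E (F i) h) - c i *: E (F i) h)) <= eta' * d.
  apply: filter_forall => i.
  exact: eigen_first_order (piece_dom (ltn_ord i)) eta'0.
near=> d; move=> s s0.
have d0 : 0 < d by near: d; exact: nbhs_right_gt.
have hid : forall i : 'I_n,
    rnorm (P d (E (F i) h) - cexp (- (c i * d%:C)) *: E (F i) h
      + d%:C *: (A (E (F i) h) - c i *: E (F i) h)) <= eta' * d by near: d.
pose r := \sum_(i < n) cexp (- (c i * s%:C)) *: (A (E (F i) h) - c i *: E (F i) h).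
pose q := \sum_(i < n) cexp (- (c i * s%:C)) *:
  (P d (E (F i) h) - cexp (- (c i * d%:C)) *: E (F i) h
      + d%:C *: (A (E (F i) h) - c i *: E (F i) h)).
have -> : P d (spectral_sum n F c h s) - spectral_sum n F c h (s + d) =
    q - d%:C *: r.
  rewrite /spectral_sum /q /r linear_sum -sumrB scaler_sumr -sumrB.
  apply: eq_bigr => i _; rewrite linearZ /= rmorphD mulrDr opprD cexpD.
  by rewrite scalerDr scalerBr !scalerA [d%:C * _]mulrC addrK.
apply: le_trans (ler_rnormD _ _) _; rewrite rnormN rnormZ rnormC gtr0_norm//.
rewrite mulrDr addrC; apply: lerD.
  by rewrite ler_pM2l//; exact: residual_le.
apply: le_trans (ler_rnorm_sum _ _) _.
apply: (@le_trans _ _ (\sum_(i < n) eta' * d)).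
  apply: ler_sum => i _; rewrite rnormZ.
  have := rnorm_cexp_le1 (ltn_ord i) s0.
  have := rnorm_ge0 (cexp (- (c i * s%:C))).
  have := hid i; set x := rnorm (_ + _); have : 0 <= x by exact: rnorm_ge0.
  nra.
rewrite sumr_const card_ord -mulr_natl [eta' * d]mulrC mulrCA ler_pM2l//.
rewrite /eta' mulrCA ler_piMr ?(ltW eta0)// ler_pdivrMr// mul1r ler_nat.
exact: leqnSn.
Unshelve. all: by end_near. Qed.

(** Over each small step [d] the semigroup and the spectral sum move apart by
    about [d * (8 * e * |h|)]; [P d] does not expand the distance already
    present, so these errors add up linearly in time. *)
Lemma semigroup_spectral_sum t : 0 <= t ->
  rnorm (P t (E D h) - spectral_sum n F c h t) <= t * (8 * e * rnorm h).
Proof.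
have S0 : spectral_sum n F c h 0 = E D h.
  rewrite (pvm_sum _ _ pD); apply: eq_bigr => i _.
  by rewrite mulr0 oppr0 cexp0 scale1r.
have [P0 PD _ _] := semigroupP.
rewrite le_eqVlt => /orP[/eqP <-|t0].
  by rewrite P0 S0 subrr rnorm0 mul0r.
apply: le_addeps => eta eta0.
have eta't : 0 < eta / t by rewrite divr_gt0.
have step : \forall d \near (0 : R)^'+, 0 < d /\ forall s, 0 <= s ->
    rnorm (P d (spectral_sum n F c h s) - spectral_sum n F c h (s + d))
      <= d * (8 * e * rnorm h + eta / t).
  by near=> d; split; near: d; [exact: nbhs_right_gt|exact: spectral_sum_step].
have [N [d0 hN]] := near_right_step t0 step.
set d := t / N.+1%:R in d0 hN.
have tele k : rnorm (P (k%:R * d) (E D h) - spectral_sum n F c h (k%:R * d))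
    <= k%:R * (d * (8 * e * rnorm h + eta / t)).
  elim: k => [|k ih]; first by rewrite !mul0r P0 S0 subrr rnorm0.
  have kd : 0 <= k%:R * d by rewrite mulr_ge0 ?(ltW d0).
  rewrite -natr1 !(mulrDl k%:R 1) !mul1r.
  have PE : P (k%:R * d + d) (E D h) = P d (P (k%:R * d) (E D h)).
    by rewrite addrC PD ?(ltW d0).
  rewrite PE.
  have -> : P d (P (k%:R * d) (E D h)) - spectral_sum n F c h (k%:R * d + d) =
      P d (P (k%:R * d) (E D h) - spectral_sum n F c h (k%:R * d)) +
      (P d (spectral_sum n F c h (k%:R * d)) - spectral_sum n F c h (k%:R * d + d)).
    by rewrite (linearB (P d)) addrA subrK.
  apply: le_trans (ler_rnormD _ _) _; apply: lerD; last exact: hN.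
  by apply: le_trans ih; exact: semigroup_le (ltW d0).
have dt : N.+1%:R * d = t by rewrite /d mulrC divfK ?pnatr_eq0.
have := tele N.+1; rewrite mulrA dt mulrDr [t * (eta / t)]mulrC divfK//.
exact: lt0r_neq0.
Unshelve. all: by end_near. Qed.

End Approximation.
End SemigroupCalculus.

(** * Spectral representation of the semigroup *)

Section SemigroupSpectral.
Context (R : realType) (H : hilbertType R) (A : unbounded_op H H) (E : pvm H).
Context (P : R -> bounded_op H H).
Hypothesis spectralE : spectral_measure A E.
Hypothesis semigroupP : contraction_semigroup P.
Hypothesis generatorP : is_generator P (op_opp A).
Hypothesis spectrum_ge0 : spectrum A `<=` [set z | 0 <= complex.Re z].
Implicit Types (v w h : H) (D X : set (Cborel R)) (t : R).

Let sigma : set (Cborel R) := spectrum A.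

Let msigma : measurable sigma. Proof. exact: spectrum_measurable. Qed.

Lemma pvm_spectrum h : E sigma h = h.
Proof.
have := spectrum_full spectralE h; rewrite pvm_compl//.
by move/eqP; rewrite subr_eq0 => /eqP.
Qed.

Lemma spectral_kernel_bmeasurable t : 0 <= t ->
  bmeasurable sigma (fun z : R[i] => cexp (- (z * t%:C))).
Proof. by move=> t0; apply: cexp_kernel_bmeasurable => // z /spectrum_ge0. Qed.

Lemma spectral_kernel_le1 t (z : R[i]) : 0 <= t -> sigma z ->
  rnorm (cexp (- (z * t%:C))) <= 1.
Proof.
move=> t0 /spectrum_ge0 /= z0; rewrite rnorm_cexp complexReN complexReM /=.
by rewrite mulr0 subr0 -expR0 ler_expR oppr_le0 mulr_ge0.
Qed.

(** A partition of [D] into cells of diameter about [e] approximates both sides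
    by the same spectral sum: the left one by the evolution equation, the right
    one because [exp (- z t)] is Lipschitz on [Re z >= 0]. *)
Lemma semigroup_spectral_bounded D (N : R) h w t : measurable D -> D `<=` sigma ->
  (forall z : R[i], D z -> rnorm z <= N) -> 0 <= t ->
  hdot (P t (E D h)) w =
    cintegral (pvm_measure E (E D h) w) sigma (fun z => cexp (- (z * t%:C))).
Proof.
move=> mD Ds DN t0.
pose phi (z : R[i]) : R[i] := cexp (- (z * t%:C)).
have bphi := spectral_kernel_bmeasurable t0.
have bphiD : bmeasurable D phi.
  have [m1 m2 [M hM]] := bphi.
  split; [exact: measurable_funS m1|exact: measurable_funS m2|].
  by exists M => z /Ds; exact: hM.
have bid : bmeasurable D (fun z : Cborel R => z : R[i]).
  split; last by exists N.
    exact: (measurable_funS measurableT _ (@Re_measurable R)).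
  exact: (measurable_funS measurableT _ (@Im_measurable R)).
set nu := pvm_measure E (E D h) w.
have nuB X : measurable X -> rnorm (nu X) <= rnorm (E D h) * rnorm w.
  exact: rnorm_hdot_pvm.
have -> : cintegral nu sigma phi = cintegral nu D phi.
  apply: cintegral_null => //; [by case: bphi|by case: bphi|by case: bphiD|].
  move=> X mX XD; rewrite /nu /= pvm_disj ?linear0l//.
  exact/disjoints_subset.
apply/eqP; rewrite -subr_eq0 -rnorm_eq0 eq_le rnorm_ge0 andbT.
apply: (@le_mulgt0 _ _ (t * (16 * rnorm h * rnorm w))) => e e0.
have [n [F [c [pD [hF cF]]]]] := bmeasurable_partition mD bid e0.
have c0 i : (i < n)%N -> 0 <= complex.Re (c i).
  move=> iN; have [[z Fz ->]|[_ ->]//] := cF i.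
  exact: spectrum_ge0 (Ds _ (mpartition_sub pD iN Fz)).
have h1 := semigroup_spectral_sum spectralE semigroupP generatorP h pD
  (ltW e0) hF c0 t0.
have hphi i : (i < n)%N -> forall z, F i z ->
    rnorm (phi z - cexp (- (c i * t%:C))) <= t * e.
  move=> iN z Fz; apply: le_trans (cexp_lipschitz _ _) _.
  - rewrite complexReN complexReM /= mulr0 subr0 oppr_le0 mulr_ge0//.
    exact: spectrum_ge0 (Ds _ (mpartition_sub pD iN Fz)).
  - by rewrite complexReN complexReM /= mulr0 subr0 oppr_le0 mulr_ge0// c0.
  rewrite opprK addrC -mulrBl rnormM rnormC ger0_norm// mulrC ler_wpM2l//.
  by rewrite rnormBC; exact: hF.
have h2 := cintegral_approx nuB (mulr_ge0 t0 (ltW e0)) pD bphiD hphi.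
have sE : \sum_(i < n) cexp (- (c i * t%:C)) * nu (F i) =
    hdot (spectral_sum E n F c h t) w.
  rewrite /spectral_sum hdot_suml; apply: eq_bigr => i _.
  rewrite hdotZl /nu /=; congr (_ * hdot _ w).
  have [mF _ _] := pD; apply: pvm_sub => //; exact: mpartition_sub pD (ltn_ord i).
rewrite sE in h2; set S := spectral_sum E n F c h t in h1 h2.
have -> : hdot (P t (E D h)) w - cintegral nu D phi =
    hdot (P t (E D h) - S) w - (cintegral nu D phi - hdot S w).
  by rewrite linearBl /= opprB addrA subrK.
apply: le_trans (ler_rnormD _ _) _; rewrite rnormN.
apply: le_trans (lerD (rnorm_hdot _ _) h2) _.
have := ler_wpM2r (rnorm_ge0 w) h1.
have te : 0 <= 8 * rnorm w * (t * e) by rewrite !mulr_ge0 ?rnorm_ge0// ltW.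
have := ler_wpM2l te (rnorm_pvm_le E h mD).
by lra.
Qed.

Lemma pvm_tail_small h (e : R) : 0 < e ->
  exists N : nat, rnorm (h - E (sigma `&` disk 0 N%:R) h) < e.
Proof.
move=> e0; pose F n : set (Cborel R) := sigma `&` disk 0 n%:R.
have mF n : measurable (F n).
  by apply: measurableI => //; exact: disk_measurable.
have ndF n m : (n <= m)%N -> F n `<=` F m.
  move=> nm z [sz zn]; split => //; apply: lt_le_trans zn _.
  by rewrite ler_nat.
have FE : \bigcup_n F n = sigma.
  apply/seteqP; split => [z [k _ []]//|z sz].
  exists (Num.truncn (rnorm (z : R[i]))).+1 => //; split => //.
  by rewrite /disk /= subr0; exact: truncnS_gt.
have := @pvm_cvg_nondecreasing _ _ E F h mF ndF.
rewrite FE pvm_spectrum => /cvg_rnorm_seqP/(_ e e0)[N hN].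
by exists N; exact: hN.
Qed.

(** Both sides are continuous in [h], uniformly for the norm of [h], since
    [exp (- z t)] is at most one on the spectrum; truncations of [h] to bounded
    parts of the spectrum are dense. *)
Lemma semigroup_spectral h w t : 0 <= t ->
  hdot (P t h) w =
    cintegral (pvm_measure E h w) sigma (fun z => cexp (- (z * t%:C))).
Proof.
move=> t0; have bphi := spectral_kernel_bmeasurable t0.
apply/eqP; rewrite -subr_eq0 -rnorm_eq0 eq_le rnorm_ge0 andbT.
apply: (@le_mulgt0 _ _ (9 * rnorm w)) => e e0.
have [N hN] := pvm_tail_small h e0.
set D := sigma `&` _ in hN.
have mD : measurable D by apply: measurableI => //; exact: disk_measurable.
set h' := E D h in hN.
have eq1 : hdot (P t h') w =
    cintegral (pvm_measure E h' w) sigma (fun z => cexp (- (z * t%:C))).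
  apply: (@semigroup_spectral_bounded D N%:R) => //; first by move=> z [].
  by move=> z [_ /ltW]; rewrite subr0.
have lin : cintegral (pvm_measure E h w) sigma (fun z => cexp (- (z * t%:C))) =
    cintegral (pvm_measure E h' w) sigma (fun z => cexp (- (z * t%:C))) +
    1 * cintegral (pvm_measure E (h - h') w) sigma (fun z => cexp (- (z * t%:C))).
  have hh' := rnorm_pvm_le E h mD.
  have w0 := rnorm_ge0 w.
  apply: (@cintegral_linear _ _ _ (2 * rnorm h * rnorm w)) => //.
  - move=> X mX; apply: le_trans (rnorm_hdot_pvm _ _ _ mX) _.
    by rewrite ler_wpM2r//; have := rnorm_ge0 h; lra.
  - move=> X mX; apply: le_trans (rnorm_hdot_pvm _ _ _ mX) _.
    by rewrite ler_wpM2r//; have := rnorm_ge0 h; move: hh'; rewrite -/h'; lra.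
  - move=> X mX; apply: le_trans (rnorm_hdot_pvm _ _ _ mX) _.
    rewrite ler_wpM2r//; apply: le_trans (ler_rnormD _ _) _; rewrite rnormN.
    by move: hh'; rewrite -/h'; lra.
  - by move=> X mX /=; rewrite mul1r -linearDl /= -linearD addrC subrK.
rewrite lin -eq1 mul1r opprD addrA -linearBl -linearB.
apply: le_trans (ler_rnormD _ _) _; rewrite rnormN.
have b1 : rnorm (hdot (P t (h - h')) w) <= e * rnorm w.
  apply: le_trans (rnorm_hdot _ _) _; rewrite ler_wpM2r ?rnorm_ge0//.
  by apply: le_trans (semigroup_le semigroupP _ t0) _; exact: ltW.
have b2 : rnorm (cintegral (pvm_measure E (h - h') w) sigma
    (fun z => cexp (- (z * t%:C)))) <= 8 * (rnorm (h - h') * rnorm w) * 1.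
  apply: cintegral_le_const => //.
    by move=> X mX; exact: rnorm_hdot_pvm.
  by move=> z; exact: spectral_kernel_le1.
have := ler_wpM2r (rnorm_ge0 w) (ltW hN); move: b1 b2; lra.
Qed.

End SemigroupSpectral.

(** * Intertwining and convergence to the fixed vectors *)

Section FixedSpace.
Context (R : realType) (H : hilbertType R) (P : R -> bounded_op H H).
Hypothesis semigroupP : contraction_semigroup P.
Implicit Types f k : H.

(** A vector fixed by a contraction is also fixed by its adjoint: the contraction
    does not increase the norm of [k + a f] for any [a], and the terms of first
    order in [a] have to agree. *)
Lemma fixed_space_adjoint k f t : 0 <= t -> fixed_space P k ->
  hdot (P t f) k = hdot f k.
Proof.
move=> t0 /(_ t t0) Pk; apply/eqP; rewrite -subr_eq0; apply/eqP.
apply: (@first_order_eq0 _ _ (rnorm f ^+ 2)) => a.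
have := semigroup_le semigroupP (k + a *: f) t0.
rewrite linearD linearZ /= Pk -(@ler_pXn2r _ 2) ?nnegrE ?rnorm_ge0//.
rewrite !rnorm_sqrD (hdotC (a *: P t f)) (hdotC (a *: f)) !complexRe_conj.
rewrite !hdotZl !rnormZ !exprMn mulrBr complexReD complexReN.
have : 0 <= rnorm a ^+ 2 * rnorm (P t f) ^+ 2 by rewrite mulr_ge0 ?sqr_ge0.
by lra.
Qed.

Lemma fixed_space_closed : closed_subspace (fixed_space P).
Proof.
split; first by move=> t _; rewrite linear0.
- by move=> a x y Px Py t t0; rewrite linearP Px// Py.
- move=> x h t t0; apply/eqP; rewrite -subr_eq0 -rnorm_eq0 eq_le rnorm_ge0 andbT.
  apply: (@le_mulgt0 _ _ 2) => e /h[s Ps xs].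
  have -> : P t x - x = P t (x - s) - (x - s).
    by rewrite linearB Ps// opprB addrA subrK.
  apply: le_trans (ler_rnormD _ _) _; rewrite rnormN.
  have := semigroup_le semigroupP (x - s) t0; lra.
Qed.

(** Both [P t] and the projection are contractions, so an estimate on a dense
    set of vectors extends to all of them. *)
Lemma semigroup_estimate_dense (S : set H) (t C : R) : 0 <= t -> 0 <= C ->
  (forall f (e : R), 0 < e -> exists2 s, S s & rnorm (f - s) < e) ->
  (forall f, S f -> rnorm (P t f - P_infty P f) <= C * rnorm (f - P_infty P f)) ->
  forall f, rnorm (P t f - P_infty P f) <= C * rnorm (f - P_infty P f).
Proof.
move=> t0 C0 dS hS f; rewrite -subr_le0.
apply: (@le_mulgt0 _ _ (2 + C)) => e /(dS f)[s Ss fs].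
have cF := fixed_space_closed.
have h1 : rnorm (P t (f - s)) <= e.
  by apply: le_trans (semigroup_le semigroupP _ t0) (ltW fs).
have [h2 h3] := rnorm_oproj_le (f - s) cF.
have h4 := hS s Ss.
have e1 : P t f - P_infty P f =
    (P t s - P_infty P s) + (P t (f - s) - P_infty P (f - s)).
  rewrite /P_infty oprojB// (linearB (P t)).
  by rewrite subrACA [RHS]addrC subrK.
have e2 : s - P_infty P s = (f - P_infty P f) - ((f - s) - P_infty P (f - s)).
  by rewrite /P_infty oprojB// [f - s - _]subrACA subKr.
have h5 : rnorm (P t f - P_infty P f) <= rnorm (P t s - P_infty P s) + (e + e).
  rewrite e1; apply: le_trans (ler_rnormD _ _) _; rewrite lerD2l.
  apply: le_trans (ler_rnormD _ _) _; rewrite rnormN; apply: lerD => //.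
  by apply: le_trans h2 (ltW fs).
have h6 : rnorm (s - P_infty P s) <= rnorm (f - P_infty P f) + e.
  rewrite e2; apply: le_trans (ler_rnormD _ _) _; rewrite rnormN lerD2l.
  by apply: le_trans h3 (ltW fs).
have := ler_wpM2l C0 h6; lra.
Qed.

End FixedSpace.

Section Intertwining.
Context (R : realType) (H Ht : hilbertType R).
Context (P : R -> bounded_op H H) (Pt : R -> bounded_op Ht Ht).
Context (A : unbounded_op Ht Ht) (gamma1 : R) (E : pvm Ht) (L : bounded_op Ht H).
Hypothesis semigroupP : contraction_semigroup P.
Hypothesis semigroupPt : contraction_semigroup Pt.
Hypothesis generatorPt : is_generator Pt (op_opp A).
Hypothesis gapA : spectral_gap A gamma1.
Hypothesis spectralE : spectral_measure A E.
Hypothesis properL : proper_intertwining P Pt E L.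

Let sigma : set (Cborel R) := spectrum A.
Let msigma : measurable sigma. Proof. exact: spectrum_measurable. Qed.
Let spectrum_ge0 : spectrum A `<=` [set z | 0 <= complex.Re z].
Proof. by case: gapA. Qed.
Let gamma1_gt0 : 0 < gamma1. Proof. by case: gapA. Qed.
Let zero : set (Cborel R) := [set 0 : R[i]].
Let mzero : measurable zero. Proof. exact: set1_measurable. Qed.

(** The pseudo-inverse may be replaced by any preimage, because the kernel of
    [L] is invariant under the spectral projections. *)
Lemma F_op_range (X : set (Cborel R)) (h : Ht) : measurable X ->
  F_op E L X (L h) = L (E X h).
Proof.
move=> mX; have [_ _ inv] := properL.
have cK := op_ker_closed L.
have [[_ /= K1] K2] := oprojP h cK.
set h0 := Defs.pinv L (L h).
have [_ pinvE] : orthocompl (op_ker (total_op L)) h0 /\ L h0 = L h.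
  apply: (@xgetPex _ 0 [set x | orthocompl (op_ker (total_op L)) x /\ L x = L h]).
  exists (h - oproj (op_ker (total_op L)) h); split => //.
  by rewrite linearB /= K1 subr0.
have := @ker_invariant _ _ _ L (E X) (@pvm_selfadjoint _ _ E X mX) (inv X mX)
  (h0 - h).
rewrite linearB /= pinvE subrr => /(_ erefl); rewrite linearB linearB /=.
by move/eqP; rewrite subr_eq0 => /eqP.
Qed.

Lemma F_measureE (h : Ht) (g : H) (X : set (Cborel R)) : measurable X ->
  F_measure E L (L h) g X = pvm_measure E h (adjoint (total_op L) g) X.
Proof. by move=> mX; rewrite /= F_op_range// adjoint_total. Qed.

Lemma F_measure_bounded (h : Ht) (g : H) (X : set (Cborel R)) : measurable X ->
  rnorm (F_measure E L (L h) g X) <= rnorm h * rnorm (adjoint (total_op L) g).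
Proof. by move=> mX; rewrite F_measureE//; exact: rnorm_hdot_pvm. Qed.

(** Transport of the spectral representation of [Pt] by [L]. *)
Lemma semigroup_F_integral (f g : H) (t : R) : 0 <= t -> range L f ->
  hdot (P t f) g =
    cintegral (F_measure E L f g) sigma (fun z => cexp (- (z * t%:C))).
Proof.
move=> t0 [h _ <-]; have [PL _ _] := properL.
rewrite PL// adjoint_total.
rewrite (semigroup_spectral spectralE semigroupPt generatorPt spectrum_ge0)//.
rewrite (@cintegral_linear _ _ _ (rnorm h * rnorm (adjoint (total_op L) g)) 0
  (F_measure E L (L h) g) (pvm_measure E h (adjoint (total_op L) g))
  (pvm_measure E h (adjoint (total_op L) g))) ?mul0r ?addr0//.
- by move=> X mX; exact: F_measure_bounded.
- by move=> X mX; exact: rnorm_hdot_pvm.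
- by move=> X mX; exact: rnorm_hdot_pvm.
- by move=> X mX; rewrite mul0r addr0 F_measureE.
- exact: (spectral_kernel_bmeasurable spectrum_ge0 t0).
Qed.

Let high : set (Cborel R) := sigma `&` ~` [set z : R[i] | complex.Re z < gamma1].
Let mhigh : measurable high.
Proof. by apply: measurableI => //; apply: measurableC; exact: halfplane_measurable. Qed.

(** Outside [high] and [0] there are only the resolvent set and the gap, and both
    are null. *)
Lemma pvm_compl_kernel_null (h : Ht) (X : set (Cborel R)) : measurable X ->
  X `<=` ~` high -> E X (E (~` zero) h) = 0.
Proof.
move=> mX Xhigh; rewrite -[E X _](pvm_spectrum spectralE).
have mZ : measurable (~` zero) by exact: measurableC.
rewrite -pvmI// -pvmI//; last exact: measurableI.
apply: (@pvm_null_sub _ _ E _ ([set z : R[i] | complex.Re z < gamma1] `\ 0)).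
- by apply: measurableI => //; exact: measurableI.
- by apply: measurableD; [exact: halfplane_measurable|exact: set1_measurable].
- move=> z [[sz Xz] z0]; split => //.
  by apply: contrapT => h1; exact: (Xhigh z Xz).
- by move=> f; exact: (gap_null spectralE f gapA).
Qed.

(** For the one-cell partition [{0}], of mesh [0], the spectral sum is exact and
    constant in time. *)
Lemma semigroup_kernel_fixed (h : Ht) (t : R) : 0 <= t -> Pt t (E zero h) = E zero h.
Proof.
move=> t0.
have pD : mpartition zero 1 (fun=> zero).
  split => //; first by move=> i j /=; case: i j => [|//] [].
  by apply/seteqP; split => [x [k _]//|x Dx]; exists 0%N.
have he i : (i < 1)%N -> forall z : R[i], zero z -> rnorm (z - cst 0 i) <= (0 : R).
  by move=> _ z ->; rewrite subrr rnorm0.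
have hc i : (i < 1)%N -> 0 <= complex.Re (cst (0 : R[i]) i) by [].
have := semigroup_spectral_sum spectralE semigroupPt generatorPt h pD (lexx 0) he hc t0.
rewrite mulr0 mul0r mulr0 /spectral_sum big_ord1 /= mul0r oppr0 cexp0 scale1r => n0.
by apply/eqP; rewrite -subr_eq0 -rnorm_eq0 eq_le n0 rnorm_ge0.
Qed.

Lemma semigroup_decay (h w : Ht) (t : R) : 0 <= t ->
  rnorm (hdot (Pt t (E (~` zero) h)) w) <=
    8 * (rnorm (E (~` zero) h) * rnorm w) * expR (- (gamma1 * t)).
Proof.
move=> t0; rewrite (semigroup_spectral spectralE semigroupPt generatorPt spectrum_ge0)//.
have bphi := spectral_kernel_bmeasurable spectrum_ge0 t0.
set nu := pvm_measure _ _ _.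
have hs : high `<=` sigma by move=> z [].
have bphih : bmeasurable high (fun z : R[i] => cexp (- (z * t%:C))).
  have [m1 m2 [M hM]] := bphi.
  split; [exact: measurable_funS m1|exact: measurable_funS m2|].
  by exists M => z /hs; exact: hM.
have -> : cintegral nu (spectrum A) (fun z => cexp (- (z * t%:C))) =
    cintegral nu high (fun z => cexp (- (z * t%:C))).
  apply: cintegral_null => //; [by case: bphi|by case: bphi|by case: bphih|].
  by move=> X mX Xh; rewrite /nu /= pvm_compl_kernel_null// linear0l.
apply: cintegral_le_const => //; [by move=> X; exact: rnorm_hdot_pvm|].
move=> z [_ /negP]; rewrite -leNgt => zg.
rewrite rnorm_cexp complexReN complexReM /= mulr0 subr0 ler_expR lerN2.
by rewrite ler_wpM2r.
Qed.

(** The brackets of [L h - L (E {0} h)] with a fixed vector are constant along the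
    semigroup, and they decay exponentially. *)
Lemma P_infty_range (h : Ht) : P_infty P (L h) = L (E zero h).
Proof.
have [PL _ _] := properL.
apply: (oproj_eq (fixed_space_closed semigroupP)).
  by move=> t t0; rewrite PL// semigroup_kernel_fixed.
move=> k Pk; rewrite -linearB -pvm_compl//.
set h' := E (~` zero) h; set w := adjoint (total_op L) k.
apply/eqP; rewrite -rnorm_eq0 eq_le rnorm_ge0 andbT.
apply: (@le_mulgt0 _ _ (8 * (rnorm h' * rnorm w))) => e e0.
(* Then [gamma1 * t = 1 / e], and [exp (- 1 / e) <= e]. *)
pose t := e^-1 / gamma1.
have t0 : 0 <= t by rewrite divr_ge0 ?invr_ge0 ?(ltW e0) ?(ltW gamma1_gt0).
rewrite -(fixed_space_adjoint semigroupP _ t0 Pk) PL// adjoint_total -/w.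
apply: le_trans (semigroup_decay h w t0) _.
rewrite -/h' ler_wpM2l ?mulr_ge0 ?rnorm_ge0//.
have -> : gamma1 * t = e^-1 by rewrite /t mulrC divfK// lt0r_neq0.
rewrite expRN -[leRHS]invrK lef_pV2 ?posrE ?expR_gt0 ?invr_gt0//.
by apply: le_trans (expR_ge1Dx _); rewrite lerDr.
Qed.

(** Off the kernel [exp (- z t) = M z * m z], and the total variation of [<F f, g>]
    weighted by [m] is controlled by the hypothesis on [F]. *)
Lemma semigroup_estimate_range (m : R[i] -> R[i]) (t S : R) (h : Ht) :
  0 <= t -> 0 <= S ->
  measurable_fun sigma (m : Cborel R -> Cborel R) ->
  (forall z, spectrum A z -> m z != 0) ->
  (forall z, spectrum A z -> rnorm (M_fun m gamma1 t z) <= S) ->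
  (forall f g : H, range L f ->
    (\int[tv (F_measure E L f g)]_(z in sigma)
       (rnorm (m z))%:E <= (rnorm f * rnorm g)%:E)%E) ->
  rnorm (P t (L h) - P_infty P (L h)) <= S * rnorm (L h - P_infty P (L h)).
Proof.
move=> t0 S0 mm m0 MS hyp_a; have [PL _ _] := properL.
rewrite P_infty_range -linearB -pvm_compl//; set h' := E (~` zero) h.
have -> : P t (L h) - L (E zero h) = P t (L h').
  rewrite /h' pvm_compl// linearB linearB /= [P t (L (E zero h))]PL//.
  by rewrite semigroup_kernel_fixed.
apply: rnorm_le_hdot; first by rewrite mulr_ge0 ?rnorm_ge0.
move=> g; have Lh' : range L (L h') by exists h'.
rewrite semigroup_F_integral//.
have bphi := spectral_kernel_bmeasurable spectrum_ge0 t0.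
have nuB (X : set (Cborel R)) : measurable X ->
    rnorm (F_measure E L (L h') g X) <= rnorm h' * rnorm (adjoint (total_op L) g).
  exact: F_measure_bounded.
rewrite -lee_fin; apply: le_trans (rnorm_cintegral_le_tv nuB msigma bphi) _.
set N : set (Cborel R) := sigma `&` [set z : R[i] | complex.Re z < gamma1].
have mN : measurable N by apply: measurableI => //; exact: halfplane_measurable.
have tvN : tv (F_measure E L (L h') g) N = 0%E.
  apply: tv_null => X mX XN; rewrite F_measureE//= pvm_compl_kernel_null ?linear0l//.
  by move=> z /XN[_ /= zg] [_].
have mrm : measurable_fun sigma (fun z : Cborel R => (rnorm (m z))%:E).
  apply/measurable_EFinP.
  exact: (measurableT_comp (@rnorm_measurable R) mm).
have mrphi : measurable_fun sigma
    (fun z : Cborel R => (rnorm (cexp (- ((z : R[i]) * t%:C))))%:E).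
  by apply/measurable_EFinP; exact: rnorm_bmeasurable bphi.
rewrite (ge0_negligible_integral mN)//; last by move=> z _; rewrite lee_fin rnorm_ge0.
have mD : measurable (sigma `\` N) by exact: measurableD.
have DS : sigma `\` N `<=` sigma by move=> z [].
apply: (@le_trans _ _ (S%:E * \int[tv (F_measure E L (L h') g)]_(z in sigma)
    (rnorm (m z))%:E)%E); last first.
  by rewrite -mulrA EFinM lee_wpmul2l ?lee_fin//; exact: hyp_a.
have m_ge0 (z : R[i]) : (0 <= (rnorm (m z))%:E)%E by rewrite lee_fin rnorm_ge0.
have mSm : measurable_fun sigma (fun z : Cborel R => (S%:E * (rnorm (m z))%:E)%E).
  by apply/measurable_EFinP; apply: measurable_funM => //; exact/measurable_EFinP.
rewrite -ge0_integralZl_EFin//.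
apply: (@le_trans _ _ (\int[tv (F_measure E L (L h') g)]_(z in sigma `\` N)
    (S%:E * (rnorm (m z))%:E))%E).
  apply: ge0_le_integral => //.
  - by move=> z _; rewrite lee_fin rnorm_ge0.
  - exact: (measurable_funS msigma DS mrphi).
  - exact: (measurable_funS msigma DS mSm).
  - move=> z [sz nNz]; rewrite -EFinM lee_fin.
    have zg : gamma1 <= complex.Re (z : R[i]).
      by rewrite leNgt; apply/negP => h1; apply: nNz.
    have := MS z sz; rewrite /M_fun zg => zS.
    rewrite -[leLHS]mulr1 -(@mulVf _ (rnorm (m z))) ?rnorm_eq0 ?m0//.
    by rewrite mulrA -rnormV -rnormM ler_wpM2r ?rnorm_ge0.
apply: ge0_subset_integral => //.
by move=> z _; rewrite mule_ge0// lee_fin.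
Qed.

End Intertwining.

Section SupNorm.
Context (R : realType).

Lemma supnorm_ge0 (D : set R[i]) (phi : R[i] -> R[i]) : 0 <= supnorm D phi.
Proof.
rewrite /supnorm; set X := (X in sup X).
have [bX|nbX] := pselect (has_sup X); last by rewrite sup_out.
case: bX => - [x [z Dz phix]] ub.
apply: (@le_trans _ _ x); first by rewrite -phix rnorm_ge0.
by apply: ub_le_sup => //; exists z.
Qed.

Lemma supnorm_ge (D : set R[i]) (phi : R[i] -> R[i]) (M : R) :
  (forall z, D z -> rnorm (phi z) <= M) ->
  forall z, D z -> rnorm (phi z) <= supnorm D phi.
Proof.
move=> hM z Dz; apply: ub_le_sup; last by exists z.
by exists M => _ [w Dw <-]; exact: hM.
Qed.

End SupNorm.

Theorem theorem2p1 (R : realType) (H Ht : hilbertType R)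
    (sepH : separable H) (sepHt : separable Ht)
    (P : R -> bounded_op H H) (Pt : R -> bounded_op Ht Ht)
    (A : unbounded_op Ht Ht) (gamma1 : R) (E : pvm Ht) (L : bounded_op Ht H)
    (semigroupP : contraction_semigroup P)
    (semigroupPt : contraction_semigroup Pt)
    (generatorPt : is_generator Pt (op_opp A))
    (normalA : normal_op A)
    (gapA : spectral_gap A gamma1)
    (spectralE : spectral_measure A E)
    (properL : proper_intertwining P Pt E L)
    (m : R[i] -> R[i]) (m_Linfty : Linfty (spectrum A) m)
    (Tm : R) (Tm_gt0 : 0 < Tm)
    (hyp_a : forall f g : H, range L f ->
      (\int[tv (F_measure E L f g)]_(z in (spectrum A : set (Cborel R)))
         (rnorm (m z))%:E <= (rnorm f * rnorm g)%:E)%E)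
    (hyp_b : forall t : R, Tm < t ->
      (forall z, spectrum A z -> m z != 0) /\
      Linfty (spectrum A) (fun z => cexp (- (z * t%:C)) / m z)) :
  [/\ forall t : R, Tm < t -> exists T : bounded_op H H,
        extends_F_integral E L (spectrum A) (fun z => cexp (- (z * t%:C))) T,
      forall (f : H) (t : R), Tm < t ->
        rnorm (P t f - P_infty P f)
          <= supnorm (spectrum A) (M_fun m gamma1 t) * rnorm (f - P_infty P f)
    & forall t : R, Tm < t ->
        spectrum A gamma1%:C ->
        rnorm (M_fun m gamma1 t gamma1%:C)
          = supnorm (spectrum A) (M_fun m gamma1 t) ->
        forall f : H,
          rnorm (P t f - P_infty P f)
            <= (rnorm (m gamma1%:C))^-1 * expR (- (gamma1 * t))
               * rnorm (f - P_infty P f)].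
Proof.
have [PL dL _] := properL.
have spectrum_ge0 : spectrum A `<=` [set z | 0 <= complex.Re z] by case: gapA.
have ltT t : Tm < t -> 0 <= t.
  by move=> h; apply: ltW; exact: lt_trans Tm_gt0 h.
have estimate f t : Tm < t -> rnorm (P t f - P_infty P f)
    <= supnorm (spectrum A) (M_fun m gamma1 t) * rnorm (f - P_infty P f).
  move=> tT; have t0 := ltT t tT.
  have [m0 [_ [M hM]]] := hyp_b t tT.
  have MS : forall z, spectrum A z ->
      rnorm (M_fun m gamma1 t z) <= supnorm (spectrum A) (M_fun m gamma1 t).
    apply: (@supnorm_ge _ _ _ M) => z sz; rewrite /M_fun; case: ifP => _.
      exact: hM.
    by rewrite rnorm0; apply: le_trans (rnorm_ge0 _) (hM z sz).
  apply: (semigroup_estimate_dense semigroupP (S := range L) t0 (supnorm_ge0 _ _)).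
    by move=> k e e0; exact: dense_rnorm.
  move=> _ [h _ <-].
  apply: (semigroup_estimate_range semigroupP semigroupPt generatorPt gapA
    spectralE properL (m := m)) => //.
  - exact: supnorm_ge0.
  - by case: m_Linfty.
split=> [t tT|//|t tT sg Mg f].
- exists (P t) => f g rf.
  exact: (semigroup_F_integral semigroupPt generatorPt gapA spectralE properL g (ltT t tT) rf).
- have := estimate f t tT.
  rewrite -Mg /M_fun /= lexx rnormM rnormV rnorm_cexp.
  by rewrite complexReN complexReM /= mulr0 subr0 [_ * (rnorm _)^-1]mulrC.
Qed.
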